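(* Consider the initial value problem for the Degasperis-Procesi equation $$\partial_t u-\partial_x^2\partial_t u+4u\partial_x u=3\partial_x u\,\partial_x^2 u+u\,\partial_x^3 u,\quad x,t\in\mathbb{R},\qquad u(x,0)=u_0(x).$$ If $u_0\in H^{1+\delta}(\mathbb{R})\cap W^{1,\infty}(\mathbb{R})$ for some $\delta>0$, and for some open $\Omega\subseteq\mathbb{R}$ and finitely many points $\tilde x_1,\dots,\tilde x_N$ one has $u_0\big|_{\Omega}\in C^1(\Omega\setminus\{\tilde x_j\}_{j=1}^N)$, then the corresponding solution $u$ (described in the context) satisfies for $t\in[0,T]$ $$u(\cdot,t)\big|_{\Omega_t}\in C^1\big(\Omega_t\setminus\{x_j(t)\}_{j=1}^N\big),$$ where $\Omega_t=\Phi_t(\Omega)$, $x_j(t)=\Phi_t(\tilde x_j)$, and $\Phi_t(x_0)=X(t;x_0)$ is the flow defined by $$\frac{dX}{dt}=u(X(t),t),\qquad X(0)=x_0.$$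
   Context: The equation is understood in the equivalent integro-differential form $$\partial_t u+u\partial_x u+\tfrac32(1-\partial_x^2)^{-1}\partial_x(u^2)=0,\qquad (1-\partial_x^2)^{-1}f=\tfrac12 e^{-|x|}*f,$$ realized in $C([0,T]:L^2(\mathbb{R}))$. The solution: for $u_0\in H^{1+\delta}(\mathbb{R})\cap W^{1,\infty}(\mathbb{R})$, $\delta>0$, there exist $T>0$, depending on $\|u_0\|_{H^{1+\delta}}$ and $\|u_0\|_{W^{1,\infty}}$, and a unique strong solution (limit of classical solutions) $u\in C([0,T]:H^1(\mathbb{R}))\cap L^\infty([0,T]:H^{1+\delta}(\mathbb{R}))\cap L^\infty([0,T]:W^{1,\infty}(\mathbb{R}))$. For such $u$ the flow $\Phi_t$ is well defined on $[0,T]$. *)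

(* Defs.v *)
From HB Require Import structures.
From mathcomp Require Import all_boot all_order all_algebra.
From mathcomp Require Import all_classical all_reals all_analysis.
Set Implicit Arguments.
Unset Strict Implicit.
Unset Printing Implicit Defensive.
Import Order.TTheory GRing.Theory Num.Theory.
Import numFieldNormedType.Exports.
Local Open Scope classical_set_scope.
Local Open Scope ring_scope.

(* A function u of space and time is curried as u : R -> R -> R, with the time
   variable first: u t x stands for u(x,t), and u t for the profile u(.,t). *)

Section FunctionSpaces.
Context {R : realType}.
Implicit Types (f g a b phi : R -> R) (p : \bar R) (s : R).

Local Notation mu := (@lebesgue_measure R).

Definition Lp_norm p f : \bar R := 'N[mu]_p[EFin \o f]%E.

Definition test_function phi : Prop :=
  (forall (n : nat) (x : R), derivable (derive1n n phi) x 1) /\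
  exists M : R, forall x, M < `|x| -> phi x = 0.

Definition is_weak_deriv f g : Prop :=
  [/\ locally_integrable setT f, locally_integrable setT g &
      forall phi, test_function phi ->
        \int[mu]_x (f x * derive1 phi x) = - \int[mu]_x (g x * phi x)].

(* Weak derivatives are unique up to a null set; a representative is chosen
   when one exists (and the value is 0 otherwise). *)
Definition weak_deriv f : R -> R := xget (cst 0) [set g | is_weak_deriv f g].

(* The Sobolev space W^{1,p}; p = 2 gives H^1.  The norm is the usual sum norm
   (for p = 2, equivalent to the Hilbert norm), meaningful on W^{1,p} only. *)
Definition W1 p f : Prop :=
  [/\ exists g, is_weak_deriv f g, f \in Lfun mu p &
      weak_deriv f \in Lfun mu p].

Definition W1_norm p f : \bar R := (Lp_norm p f + Lp_norm p (weak_deriv f))%E.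

(* a + i b is the Fourier transform of the L^2 function f, for the convention
   fhat(xi) = int f(x) exp(-i x xi) dx, characterized by duality:
   int fhat phi = int f phihat for every (real) test function phi. *)
Definition is_fourier f a b : Prop :=
  [/\ f \in Lfun mu 2%:E, a \in Lfun mu 2%:E, b \in Lfun mu 2%:E &
      forall phi, test_function phi ->
        \int[mu]_xi (a xi * phi xi) =
          \int[mu]_x (f x * \int[mu]_xi (phi xi * cos (x * xi))) /\
        \int[mu]_xi (b xi * phi xi) =
          - \int[mu]_x (f x * \int[mu]_xi (phi xi * sin (x * xi)))].

(* The norm of H^s, s >= 0.  The pair (a, b) is unique up to a null set, so the
   infimum is over at most one value; it is +oo when f has no such transform. *)
Definition Hs_norm s f : \bar R :=
  ereal_inf [set N | exists a b, is_fourier f a b /\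
    N = ((((2 * pi)^-1)%R%:E *
          \int[mu]_xi ((1 + xi ^+ 2) `^ s * (a xi ^+ 2 + b xi ^+ 2))%R%:E)
         `^ (2^-1)%R)%E].

Definition Hs s f : Prop := (Hs_norm s f < +oo)%E.

(* (1 - d_x^2)^{-1} f = (1/2) e^{-|x|} * f *)
Definition inv_helmholtz f (x : R) : R :=
  2^-1 * \int[mu]_y (expR (- `|x - y|) * f y).

(* f is C^1 on A (used for open A). *)
Definition C1_on (A : set R) f : Prop :=
  forall x, A x -> derivable f x 1 /\ {for x, continuous (derive1 f)}.

End FunctionSpaces.

Section TimeDependent.
Context {R : realType}.
Implicit Types (T t : R) (u v w : R -> R -> R).

Local Notation mu := (@lebesgue_measure R).

Definition in_time T : set R := [set t | 0 <= t <= T].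

(* w \in C([0,T] : L^2) *)
Definition C_L2 T w : Prop :=
  forall t, in_time T t -> w t \in Lfun mu 2%:E /\
    Lp_norm 2%:E (w s \- w t) @[s --> within (in_time T) (nbhs t)] --> 0%E.

(* w \in C([0,T] : H^1) *)
Definition C_H1 T w : Prop :=
  forall t, in_time T t -> W1 2%:E (w t) /\
    W1_norm 2%:E (w s \- w t) @[s --> within (in_time T) (nbhs t)] --> 0%E.

(* w \in L^oo([0,T] : H^s) *)
Definition Linfty_Hs T (s : R) w : Prop :=
  exists M : R, {ae mu, forall t, in_time T t -> (Hs_norm s (w t) <= M%:E)%E}.

(* w \in L^oo([0,T] : W^{1,oo}) *)
Definition Linfty_W1infty T w : Prop :=
  exists M : R, {ae mu, forall t, in_time T t ->
    W1 +oo%E (w t) /\ (W1_norm +oo%E (w t) <= M%:E)%E}.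

(* w is the time derivative of u on [0,T] as an L^2-valued map (one-sided at
   the endpoints). *)
Definition is_time_deriv_L2 T u w : Prop :=
  forall t, in_time T t ->
    Lp_norm 2%:E (fun x => (u s x - u t x) / (s - t) - w t x)
      @[s --> within (in_time T) t^'] --> 0%E.

(* u_t + u u_x + (3/2) (1 - d_x^2)^{-1} d_x (u^2) = 0 in C([0,T] : L^2) *)
Definition DP_integro_differential T u : Prop :=
  exists ut : R -> R -> R,
    [/\ C_L2 T ut, is_time_deriv_L2 T u ut &
        forall t, in_time T t -> {ae mu, forall x,
          ut t x + u t x * weak_deriv (u t) x
          + 3 / 2 * inv_helmholtz (weak_deriv (fun y => u t y ^+ 2)) x = 0}].

Definition dt u : R -> R -> R := fun t x => derive1 (fun s => u s x) t.
Definition dx u : R -> R -> R := fun t x => derive1 (u t) x.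

Definition jointly_continuous_on T w : Prop :=
  forall t x, 0 < t < T -> {for (t, x), continuous (fun z : R * R => w z.1 z.2)}.

(* Solutions, in the pointwise sense, of the Degasperis-Procesi equation
     v_t - v_xxt + 4 v v_x = 3 v_x v_xx + v v_xxx. *)
Record DP_classical_solution T v : Prop := {
  DP_classical_L2 : C_L2 T v ;
  DP_classical_derivable : forall t x, 0 < t < T ->
    [/\ derivable (fun s => v s x) t 1,
        derivable (v t) x 1, derivable (dx v t) x 1,
        derivable (dx (dx v) t) x 1
      & derivable (dt v t) x 1 /\ derivable (dx (dt v) t) x 1] ;
  DP_classical_continuous :
    forall w, w \in [:: v; dt v; dx v; dx (dx v); dx (dx (dx v));
                        dx (dt v); dx (dx (dt v))] ->
      jointly_continuous_on T w ;
  DP_classical_eq : forall t x, 0 < t < T ->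
    dt v t x - dx (dx (dt v)) t x + 4 * v t x * dx v t x
    = 3 * dx v t x * dx (dx v) t x + v t x * dx (dx (dx v)) t x }.

(* u is a limit in C([0,T] : L^2) of classical solutions. *)
Definition DP_limit_of_classical T u : Prop :=
  exists v : nat -> R -> R -> R,
    (forall n, DP_classical_solution T (v n)) /\
    forall e : R, 0 < e -> \forall n \near \oo,
      forall t, in_time T t -> (Lp_norm 2%:E (v n t \- u t)%R <= e%:E)%E.

(* The strong solution on [0,T] with data u0 in H^{1+delta} and W^{1,oo}.
   Elements of H^1 are represented by their continuous representatives. *)
Record DP_strong_solution (delta T : R) (u0 : R -> R) u : Prop := {
  DP_initial : u 0 = u0 ;
  DP_representative : forall t, in_time T t -> continuous (u t) ;
  DP_C_H1 : C_H1 T u ;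
  DP_Linfty_Hs : Linfty_Hs T (1 + delta) u ;
  DP_Linfty_W1infty : Linfty_W1infty T u ;
  DP_equation : DP_integro_differential T u ;
  DP_limit : DP_limit_of_classical T u }.

(* Phi t x0 = X(t; x0), where dX/dt = u(X(t), t) on [0,T] (one-sided at the
   endpoints) and X(0) = x0. *)
Definition is_flow T u (Phi : R -> R -> R) : Prop :=
  forall x0, Phi 0 x0 = x0 /\
    forall t, in_time T t ->
      (Phi s x0 - Phi t x0) / (s - t) @[s --> within (in_time T) t^']
        --> u t (Phi t x0).

End TimeDependent.

(* Main.v *)
Require Import Defs.
From HB Require Import structures.
From mathcomp Require Import all_boot all_order all_algebra.
From mathcomp Require Import all_classical all_reals all_analysis.
From mathcomp Require Import measurable_realfun ess_sup_inf.
From mathcomp Require Import ring lra.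
Set Implicit Arguments.
Unset Strict Implicit.
Unset Printing Implicit Defensive.
Import Order.TTheory GRing.Theory Num.Theory.
Import numFieldNormedType.Exports.
Local Open Scope classical_set_scope.
Local Open Scope ring_scope.

(** In Lagrangian variables the equation is a second-order equation with a C^1
force.  Let F = 3/2 (1 - d_x^2)^{-1} d_x (u^2).  Along a characteristic
X' = u(t, X) the equation u_t + u u_x + F = 0 becomes d/dt u(t, X) = - F(t, X).
As u(t) is bounded and Lipschitz uniformly in t, d_x (u^2) is bounded, and
convolving a bounded function with the Lipschitz kernel exp(-|x|) / 2 gives a
function with Lipschitz derivative: F(t, .) is one derivative better than what
u itself offers ([inv_helmholtz_bounds], [DP_force_bounds]).

For two particles X1, X2 the difference quotient
Q = (u(t, X1) - u(t, X2)) / (X1 - X2) therefore satisfies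
  Q' = - (F(t, X1) - F(t, X2)) / (X1 - X2) - Q^2,   |Q| <= M,
where M is the Lipschitz constant of u.  The difference of two such quotients
solves a linear equation with bounded coefficient and a source measured by the
oscillation of the difference quotients of F, which is small for nearby
particles.  By Gronwall, if the difference quotients of u_0 form a Cauchy family
at y, so do those of u(t) at X(t, y) ([flow_slopes_cauchy]).  On an open set
that Cauchy property at every point is the same as being C^1
([C1_slopes_cauchy], [slopes_cauchy_C1]); the flow being a homeomorphism of the
line, neighbourhoods of y are carried to neighbourhoods of X(t, y), and the
theorem follows.  No derivative of the flow in its initial point is ever taken.

The remaining work is to justify the equation along characteristics
([characteristic_equation]) for a solution that satisfies it only in L^2.
The integral A_h of u(t) over the moving window [X, X + h] is differentiable,
with derivative the integral of u_t plus u(X) (u(X + h) - u(X)); the weak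
derivative being integrable back to u ([weak_deriv_FTC]), the transport terms
cancel up to O(h^2), which leaves A_h' = - h F(X) + O(h^2), and h tends to 0.
The bounds on u, given for almost every time, hold at every time by continuity
in L^2 ([uniform_lipschitz]). *)

(** * Calculus on an interval of time *)

Section RealCalculus.
Context {R : realType}.
Implicit Types (f g : R -> R) (a b c x y t d : R).

Lemma is_derive_epsP f t d : is_derive t 1 f d <->
  forall e : R, 0 < e -> exists2 r : R, 0 < r & forall s, `|s - t| < r ->
    `|f s - f t - (s - t) * d| <= e * `|s - t|.
Proof.
split.
- move=> /is_derive1_caratheodory[g [fg gc gt]] e e0.
  move: gc => /cvgrPdist_le/(_ e e0)/nbhs_ballP[r /= r0 rP].
  exists r => // s st.
  rewrite fg [g s * _]mulrC -mulrBr normrM mulrC ler_wpM2r//.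
  by rewrite -gt distrC; have := rP s; rewrite /ball/= [`|t - s|]distrC; apply.
- move=> H; apply/is_derive1_caratheodory.
  exists (fun z => if z == t then d else (f z - f t) / (z - t)); split.
  + move=> z; case: eqP => [->|/eqP zt]; first by rewrite !subrr mulr0.
    by rewrite divfK// subr_eq0.
  + apply/cvgrPdist_le => e e0; rewrite eqxx.
    have [r r0 rP] := H e e0.
    apply/nbhs_ballP; exists r => //= z.
    rewrite /ball/= distrC => zr.
    case: eqP => [_|/eqP zt]; first by rewrite subrr normr0 ltW.
    have zt0 : 0 < `|z - t| by rewrite normr_gt0 subr_eq0.
    rewrite -(ler_pM2r zt0) -normrM -normrN -mulNr opprB mulrBl divfK ?subr_eq0//.
    by rewrite [d * _]mulrC; exact: rP.
  + by rewrite eqxx.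
Qed.

Lemma nonincreasing_segment f (df : R -> R) a b : a <= b ->
  (forall t, a < t < b -> is_derive t 1 f (df t) /\ df t <= 0) ->
  {within `[a, b], continuous f} -> f b <= f a.
Proof.
rewrite le_eqVlt => /predU1P[->//|ab] H cf.
case: (@MVT R f df a b ab).
- by move=> x; rewrite in_itv/= => /H[+ _].
- exact: cf.
- move=> c cab E; rewrite -subr_le0 E mulr_le0_ge0 ?subr_ge0 ?(ltW ab)//.
  by move: cab; rewrite in_itv/= => /H[].
Qed.

Lemma nondecreasing_segment f (df : R -> R) a b : a <= b ->
  (forall t, a < t < b -> is_derive t 1 f (df t) /\ 0 <= df t) ->
  {within `[a, b], continuous f} -> f a <= f b.
Proof.
rewrite le_eqVlt => /predU1P[->//|ab] H cf.
case: (@MVT R f df a b ab).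
- by move=> x; rewrite in_itv/= => /H[+ _].
- exact: cf.
- move=> c cab E; rewrite -subr_ge0 E mulr_ge0 ?subr_ge0 ?(ltW ab)//.
  by move: cab; rewrite in_itv/= => /H[].
Qed.

Lemma is_derive_expRM (c t : R) :
  is_derive t 1 (fun s => expR (c * s)) (c * expR (c * t)).
Proof.
have h : is_derive t 1 (fun s : R => c * s) c.
  by apply: is_derive_eq; rewrite scaler1.
have := @is_derive1_comp _ expR (fun s : R => c * s) t _ _ (is_derive_expR _) h.
by rewrite mulrC; apply.
Qed.

Lemma continuous_expRM (c : R) : continuous (fun s : R => expR (c * s)).
Proof.
move=> s; apply: (@continuous_comp _ _ _ (fun s => c * s) expR).
  exact: mulrl_continuous.
exact: continuous_expR.
Qed.

(** A Gronwall estimate in both directions of time.  Working with r^2 + k^2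
removes any discussion of the sign of r: its derivative is at most
(1 + 2 l) (r^2 + k^2) in absolute value, so that r^2 + k^2 becomes monotone after
multiplication by an exponential. *)
Lemma gronwall_sqr (r dr : R -> R) (k l T : R) : 0 <= k -> 0 <= l -> 0 <= T ->
  (forall t, 0 < t < T -> is_derive t 1 r (dr t)) ->
  (forall t, 0 < t < T -> `|dr t| <= k + l * `|r t|) ->
  {within `[0, T], continuous r} ->
  r T ^+ 2 + k ^+ 2 <= expR ((1 + 2 * l) * T) * (r 0 ^+ 2 + k ^+ 2) /\
  r 0 ^+ 2 + k ^+ 2 <= expR ((1 + 2 * l) * T) * (r T ^+ 2 + k ^+ 2).
Proof.
move=> k0 l0 T0 dR bR cR.
set c := 1 + 2 * l.
pose z (m : R) t := expR (m * t) * (r t * r t + k ^+ 2).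
have cz m : {within `[0, T], continuous (z m)}.
  move=> x; apply: cvgM.
    have := @continuous_subspaceT _ _ `[0, T]%classic _ (@continuous_expRM m).
    by apply.
  apply: cvgD; last exact: cvg_cst.
  by apply: cvgM; exact: cR.
have dz m t : 0 < t < T ->
    is_derive t 1 (z m) (expR (m * t) * (m * (r t * r t + k ^+ 2) + 2 * r t * dr t)).
  move=> tT; have h := dR t tT; have h2 := is_derive_expRM m t.
  have h3 : is_derive t 1 (fun s => r s * r s + k ^+ 2) (r t *: dr t + r t *: dr t + 0).
    have h5 := is_derive_cst (k ^+ 2 : R) t (1 : R).
    exact: (is_deriveD (is_deriveM h h) h5).
  apply: (is_derive_eq (is_deriveM h2 h3)).
  by rewrite /GRing.scale/=; ring.
have est t : 0 < t < T -> `|2 * r t * dr t| <= c * (r t * r t + k ^+ 2).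
  move=> tT; rewrite !normrM ger0_norm//.
  apply: (@le_trans _ _ (2 * `|r t| * (k + l * `|r t|))).
    by rewrite ler_wpM2l ?bR// mulr_ge0.
  have -> : r t * r t = `|r t| ^+ 2 by rewrite -normrX ger0_norm ?sqr_ge0// expr2.
  rewrite /c; have := sqr_ge0 (`|r t| - k).
  have := sqr_ge0 k; have := mulr_ge0 l0 (sqr_ge0 k).
  nra.
have A : z (- c) T <= z (- c) 0.
  apply: (nonincreasing_segment T0 _ (cz (- c))) => t tT; split; first exact: dz.
  rewrite mulr_ge0_le0 ?expR_ge0// mulNr.
  have := est t tT; have := ler_norm (2 * r t * dr t); lra.
have B : z c 0 <= z c T.
  apply: (nondecreasing_segment T0 _ (cz c)) => t tT; split; first exact: dz.
  rewrite mulr_ge0 ?expR_ge0//.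
  have := est t tT; have := ler_norm (- (2 * r t * dr t)); rewrite normrN; lra.
move: A B; rewrite /z !mulr0 !expR0 !mul1r !expr2 => A B; split => //.
rewrite -(ler_pM2l (expR_gt0 (- c * T))) mulrA -expRD mulNr addNr expR0 mul1r.
by rewrite -mulNr.
Qed.

(** Differentiation of a limit of averages A h / h.  The continuity of a h for one
small h bounds the oscillation of g near t, because a h / h is uniformly close
to g; the mean value theorem for A k then gives the increments of U as k tends
to 0, with no continuity of g assumed beforehand. *)
Lemma derive_of_averages (U g : R -> R) (A a : R -> R -> R) (al be C h0 : R) :
  0 < h0 -> 0 <= C ->
  (forall h t, 0 < h <= h0 -> al < t < be ->
    [/\ is_derive t 1 (A h) (a h t), {for t, continuous (a h)},
        `|A h t - h * U t| <= C * h ^+ 2 & `|a h t - h * g t| <= C * h ^+ 2]) ->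
  forall t, al < t < be -> is_derive t 1 U (g t).
Proof.
move=> h00 C0 H t tab; apply/is_derive_epsP => e e0.
pose h := Num.min h0 (e / (8 * (C + 1))).
have C1 : 0 < C + 1 by rewrite ltr_pwDr.
have hpos : 0 < h by rewrite lt_min h00 divr_gt0// mulr_gt0.
have hh0 : h <= h0 by rewrite ge_min lexx.
have hC : C * h <= e / 8.
  apply: (@le_trans _ _ ((C + 1) * h)); first by rewrite ler_wpM2r ?lerDl ?(ltW hpos).
  rewrite mulrC -ler_pdivlMr//; apply: (@le_trans _ _ (e / (8 * (C + 1)))).
    by rewrite ge_min lexx orbT.
  by rewrite invfM mulrA.
have [_ ac _ agt] := H h t (introT andP (conj hpos hh0)) tab.
have he8 : 0 < h * (e / 8) by rewrite mulr_gt0// divr_gt0.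
move: ac => /cvgrPdist_le/(_ _ he8)/nbhs_ballP[r1 /= r10 r1P].
case/andP: (tab) => alt tbe.
pose r := Num.min r1 (Num.min (t - al) (be - t)).
have r0 : 0 < r by rewrite !lt_min r10 !subr_gt0 alt tbe.
have rab s : `|s - t| < r -> al < s < be.
  rewrite /r !lt_min => /and3P[_].
  by rewrite !ltr_norml => /andP[? _] /andP[_ ?]; apply/andP; split; lra.
have gest s : `|s - t| < r -> `|g s - g t| <= e / 2.
  move=> st; have [_ _ _ ags] := H h s (introT andP (conj hpos hh0)) (rab s st).
  have aa : `|a h s - a h t| <= h * (e / 8).
    by rewrite distrC; apply: r1P; rewrite /ball/= distrC (lt_le_trans st)// ge_min lexx.
  rewrite -(ler_pM2l hpos) -{1}(gtr0_norm hpos) -normrM.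
  have -> : h * (g s - g t) = (a h s - a h t) - (a h s - h * g s) + (a h t - h * g t) by ring.
  apply: (le_trans (ler_normD _ _)).
  have : C * h ^+ 2 <= h * (e / 8) by rewrite expr2 mulrA mulrC ler_wpM2l// ltW.
  have := ler_normB (a h s - a h t) (a h s - h * g s).
  lra.
exists r => // s st.
apply/ler_addgt0Pr => ep ep0.
(* k is chosen after s, so that the error C k of the averages is negligible *)
have : exists2 k : R, 0 < k <= h0 & C * k <= e / 2 /\ 2 * (C * k) <= ep.
  pose q := Num.min h0 (Num.min (e / (2 * (C + 1))) (ep / (2 * (C + 1)))).
  have qle z : q <= z / (2 * (C + 1)) -> 0 < z -> 2 * (C * q) <= z.
    move=> qz z0; have := qz; rewrite ler_pdivlMr ?mulr_gt0// => ?.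
    have : 0 <= q by rewrite /q !le_min ltW//= !divr_ge0// ?mulr_ge0// ltW.
    by move=> ?; nra.
  exists q.
    by rewrite !lt_min h00 !divr_gt0 ?mulr_gt0//= ge_min lexx.
  split; last by apply: qle => //; rewrite /q !ge_min lexx !orbT.
  have : 2 * (C * q) <= e by apply: qle => //; rewrite /q !ge_min lexx !orbT.
  lra.
case=> k k0 [kC kep].
have kpos : 0 < k by case/andP: k0.
have dA : forall x, `|x - t| < r -> is_derive x 1 (fun x => A k x - x * (k * g t)) (a k x - k * g t).
  move=> x xt; have [d1 _ _ _] := H k x k0 (rab x xt).
  have h1 : is_derive x 1 (fun x : R => x * (k * g t)) (k * g t).
    by apply: is_derive_eq; rewrite scaler0 add0r/= /GRing.scale/= mulr1.
  exact: (is_deriveB d1 h1).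
have dB x : `|x - t| < r -> `|a k x - k * g t| <= k * e.
  move=> xt; have [_ _ _ e1] := H k x k0 (rab x xt).
  have -> : a k x - k * g t = (a k x - k * g x) + k * (g x - g t) by ring.
  apply: (le_trans (ler_normD _ _)); rewrite [X in _ + X]normrM (gtr0_norm kpos).
  have : k * `|g x - g t| <= k * (e / 2) by rewrite ler_wpM2l ?gest// ltW.
  have : C * k ^+ 2 <= k * (e / 2) by rewrite expr2 mulrA mulrC ler_wpM2l// ltW.
  lra.
have mvt : `|(A k s - s * (k * g t)) - (A k t - t * (k * g t))| <= k * e * `|s - t|.
  have gen x y : x < y -> (forall z, x <= z <= y -> `|z - t| < r) ->
     `|(A k y - y * (k * g t)) - (A k x - x * (k * g t))| <= k * e * (y - x).
    move=> xy zr.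
    case: (@MVT R (fun x => A k x - x * (k * g t)) (fun x => a k x - k * g t) x y xy).
    - by move=> z; rewrite in_itv/= => /andP[? ?]; apply: dA; apply: zr; rewrite !ltW.
    - apply: derivable_within_continuous => z; rewrite in_itv/= => zxy.
      by have [] := dA z (zr z zxy).
    - move=> z; rewrite in_itv/= => /andP[xz zy] ->.
      rewrite normrM [X in _ * X]gtr0_norm ?subr_gt0// ler_wpM2r ?subr_ge0 ?(ltW xy)//.
      by apply: dB; apply: zr; rewrite !ltW.
  have [st1|ts1|->] := ltgtP s t.
  - rewrite distrC; have := gen s t st1; rewrite -opprB normrN.
    have -> : `|s - t| = t - s by rewrite ltr0_norm ?subr_lt0// opprB.
    rewrite distrC; apply => z /andP[sz zt].
    by apply: le_lt_trans st; rewrite !ler0_norm; lra.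
  - have -> : `|s - t| = s - t by rewrite gtr0_norm ?subr_gt0.
    apply: gen => // z /andP[tz zs].
    by apply: le_lt_trans st; rewrite !ger0_norm; lra.
  - by rewrite !subrr normr0 mulr0.
have [_ _ e1 _] := H k s k0 (rab s st).
have [_ _ e2 _] := H k t k0 tab.
rewrite -(ler_pM2l kpos) -{1}(gtr0_norm kpos) -normrM.
have -> : k * (U s - U t - (s - t) * g t) =
  ((A k s - s * (k * g t)) - (A k t - t * (k * g t))) - ((A k s - k * U s) - (A k t - k * U t)) by ring.
apply: (le_trans (ler_normB _ _)).
have := ler_normB (A k s - k * U s) (A k t - k * U t).
have : 2 * (C * k ^+ 2) <= k * ep by nra.
move: mvt; lra.
Qed.

End RealCalculus.

(** * Strict differentiability through difference quotients *)

Section StrictDerivative.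
Context {R : realType}.
Implicit Types (f : R -> R) (a b c x y d : R).

Definition slope f a b := (f b - f a) / (b - a).

(** Strict differentiability at x, phrased without the value of the derivative:
it compares slopes only, which is what the flow transports. *)
Definition slopes_cauchy f x := forall e : R, 0 < e -> exists2 r : R, 0 < r &
  forall a b c d, `|a - x| < r -> `|b - x| < r -> `|c - x| < r -> `|d - x| < r ->
    a != b -> c != d -> `|slope f a b - slope f c d| <= e.

Lemma slopeC f a b : slope f a b = slope f b a.
Proof. by rewrite /slope -[f b - f a]opprB -[b - a]opprB invrN mulrNN. Qed.

Lemma slopes_cauchy_limit f x : slopes_cauchy f x -> exists d,
  forall e : R, 0 < e -> exists2 r : R, 0 < r &
  forall a b, `|a - x| < r -> `|b - x| < r -> a != b -> `|slope f a b - d| <= e.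
Proof.
move=> H.
have cF : cvg ((slope f x) @ x^').
  apply/cauchy_cvgP/cauchy_ballP => e e0.
  have [r r0 rP] := H (e / 2) (divr_gt0 e0 (ltr0Sn R 1)).
  have near_r : \forall y \near x^', `|y - x| < r /\ x != y.
    rewrite /dnbhs/within/=; apply/nbhs_ballP; exists r => //= y.
    by rewrite /ball/= distrC => yr; rewrite eq_sym => yx; split.
  exists (slope f x @` [set y | `|y - x| < r /\ x != y],
          slope f x @` [set y | `|y - x| < r /\ x != y]) => /=.
    by split; apply: filterS near_r => y yr; exists y.
  move=> [_ _] /= [[y [yr xy] <-] [z [zr xz] <-]].
  rewrite /ball/=; apply: (@le_lt_trans _ _ (e / 2)); last by rewrite ltr_pdivrMr// mulr_natr mulr2n ltrDl.
  by apply: rP => //; rewrite subrr normr0.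
move/cvg_ex : cF => [d /cvgrPdist_le dP]; exists d => e e0.
have e20 : 0 < e / 2 by rewrite divr_gt0.
have [r r0 rP] := H _ e20.
exists r => // a b ar br ab.
have := dP _ e20; rewrite /dnbhs/within/= => /nbhs_ballP[s /= s0 sP].
pose y := x + Num.min r s / 2.
have m0 : 0 < Num.min r s by rewrite lt_min r0.
have xy : x != y by rewrite -subr_eq0 /y opprD addNKr oppr_eq0 gt_eqF// divr_gt0.
have nxy : `|y - x| < Num.min r s.
  by rewrite /y addrC addKr gtr0_norm ?divr_gt0// ltr_pdivrMr// mulr_natr mulr2n ltrDl.
have h1 : `|d - slope f x y| <= e / 2.
  apply: sP; last by rewrite eq_sym.
  by rewrite /ball/= distrC (lt_le_trans nxy)// ge_min lexx orbT.
have h2 : `|slope f a b - slope f x y| <= e / 2.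
  apply: rP => //; first by rewrite subrr normr0.
  by rewrite (lt_le_trans nxy)// ge_min lexx.
rewrite -(subrKA (slope f x y)) (le_trans (ler_normD _ _))//.
by move: h1; rewrite distrC; lra.
Qed.

Lemma slopes_cauchy_is_derive f x : slopes_cauchy f x -> derivable f x 1 /\
  forall e : R, 0 < e -> exists2 r : R, 0 < r &
  forall a b, `|a - x| < r -> `|b - x| < r -> a != b -> `|slope f a b - (derive1 f) x| <= e.
Proof.
move=> /slopes_cauchy_limit[d dP].
have df : is_derive x 1 f d.
  apply/is_derive_epsP => e e0; have [r r0 rP] := dP e e0; exists r => // s sr.
  have [->|sx] := eqVneq s x; first by rewrite !subrr mul0r subrr normr0 mulr0.
  have := rP x s; rewrite subrr normr0 => /(_ r0 sr).
  rewrite eq_sym => /(_ sx) h.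
  have -> : f s - f x - (s - x) * d = (slope f x s - d) * (s - x).
    by rewrite [RHS]mulrBl /slope divfK ?subr_eq0// [d * _]mulrC.
  by rewrite normrM ler_wpM2r.
split; first by have [] := df.
by rewrite derive1E (@derive_val _ _ _ _ _ _ _ df).
Qed.

(** By the mean value theorem every slope near x is a value of the derivative. *)
Lemma C1_slopes_cauchy f x :
  (\forall y \near x, derivable f y 1) -> {for x, continuous (derive1 f)} ->
  slopes_cauchy f x.
Proof.
move=> /nbhs_ballP[r1 /= r10 r1P] /cvgrPdist_le cf e e0.
have /nbhs_ballP[r2 /= r20 r2P] := cf _ (divr_gt0 e0 (ltr0Sn R 1)).
pose r := Num.min r1 r2.
have r0 : 0 < r by rewrite lt_min r10.
have H a b : `|a - x| < r -> `|b - x| < r -> a < b -> `|(derive1 f) x - slope f a b| <= e / 2.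
  move=> ar br ab.
  have inr z : a <= z <= b -> `|z - x| < r.
    move=> /andP[az zb]; move: ar br; rewrite !ltr_norml => /andP[? ?] /andP[? ?].
    by apply/andP; split; lra.
  have db z : a <= z <= b -> is_derive z 1 f ((derive1 f) z).
    move=> /inr zr; rewrite derive1E; apply: derivableP; apply: r1P.
    by rewrite /ball/= distrC (lt_le_trans zr)// ge_min lexx.
  case: (@MVT R f (derive1 f) a b ab).
  - by move=> z; rewrite in_itv/= => /andP[az zb]; apply: db; rewrite !ltW.
  - by apply: derivable_within_continuous => z; rewrite in_itv/= => /db[].
  - move=> z; rewrite in_itv/= => /andP[az zb] E.
    rewrite /slope E mulfK; last by rewrite subr_eq0 gt_eqF.
    apply: r2P; rewrite /ball/= distrC.
    by rewrite (lt_le_trans (inr z _)) ?ge_min ?lexx ?orbT// !ltW.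
have H' a b : `|a - x| < r -> `|b - x| < r -> a != b -> `|(derive1 f) x - slope f a b| <= e / 2.
  move=> ar br; rewrite neq_lt => /orP[|] ab; first exact: H.
  by rewrite slopeC; exact: H.
exists r => // a b c d ar br cr dr ab cd.
rewrite -(subrKA ((derive1 f) x)) (le_trans (ler_normD _ _))//.
have := H' _ _ ar br ab; have := H' _ _ cr dr cd; rewrite (distrC _ (slope f a b)); lra.
Qed.

(** Strict differentiability makes the derivative continuous: for y near x, one
slope taken close to y approximates the derivative both at y and at x. *)
Lemma slopes_cauchy_C1 f x : (\forall y \near x, slopes_cauchy f y) ->
  derivable f x 1 /\ {for x, continuous (derive1 f)}.
Proof.
move=> H.
have [dfx sx] := slopes_cauchy_is_derive (nbhs_singleton H).
split => //; apply/cvgrPdist_le => e e0.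
have e20 : 0 < e / 2 by rewrite divr_gt0.
have [r r0 rP] := sx _ e20.
have nr : \forall y \near x, `|y - x| < r.
  by apply/nbhs_ballP; exists r => //= y; rewrite /ball/= distrC.
near=> y.
have yr : `|y - x| < r by near: y.
have /slopes_cauchy_is_derive[_ /(_ _ e20)[s s0 sP]] : slopes_cauchy f y by near: y.
pose m := Num.min s (r - `|y - x|).
have m0 : 0 < m by rewrite lt_min s0 subr_gt0.
pose z := y + m / 2.
have m20 : 0 < m / 2 by rewrite divr_gt0.
have m2m : m / 2 < m by rewrite ltr_pdivrMr// mulr_natr mulr2n ltrDl.
have zy : `|z - y| = m / 2 by rewrite /z addrC addKr gtr0_norm.
have yz : y != z by rewrite -subr_eq0 /z opprD addNKr oppr_eq0 gt_eqF.
have h1 : `|slope f y z - (derive1 f) y| <= e / 2.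
  apply: sP => //; first by rewrite subrr normr0.
  by rewrite zy (lt_le_trans m2m)// ge_min lexx.
have h2 : `|slope f y z - (derive1 f) x| <= e / 2.
  apply: rP => //.
  rewrite -(subrKA y) (le_lt_trans (ler_normD _ _))// zy.
  have : m <= r - `|y - x| by rewrite ge_min lexx orbT.
  by move: m2m; lra.
rewrite -(subrKA (slope f y z)) (le_trans (ler_normD _ _))//.
by move: h2; rewrite distrC; lra.
Unshelve. all: by end_near. Qed.

End StrictDerivative.

(** * Second-order Lagrangian flows *)

Definition flow_growth {R : realType} (T L : R) := expR ((1 + 2 * L) * T).

(** X is a family of trajectories with velocity U and acceleration - F(t, X); the
velocity is a Lipschitz function of the position, and F has a derivative G with
a quadratic remainder. *)
Section LagrangianFlow.
Context {R : realType} (T L C : R) (X U F G : R -> R -> R).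
Context (T0 : 0 <= T) (L0 : 0 <= L) (C0 : 0 <= C).
Context (X0 : forall y, X 0 y = y).
Context (cX : forall y, {within `[0, T], continuous (X ^~ y)}).
Context (cU : forall y, {within `[0, T], continuous (U ^~ y)}).
Context (dX : forall t y : R, 0 < t < T -> is_derive t 1 (X ^~ y) (U t y)).
Context (dU : forall t y : R, 0 < t < T -> is_derive t 1 (U ^~ y) (- F t (X t y))).
Context (LU : forall t y z : R, 0 <= t <= T ->
  `|U t y - U t z| <= L * `|X t y - X t z|).
Context (FG : forall t x x' : R, 0 < t < T -> `|x' - x| <= 2^-1 ->
  `|F t x' - F t x - (x' - x) * G t x| <= C * (x' - x) ^+ 2).

Local Notation K := (flow_growth T L).

Let K_ge1 : 1 <= K.
Proof. by rewrite /flow_growth -expR0 ler_expR mulr_ge0// addr_ge0// mulr_ge0. Qed.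

Let K_gt0 : 0 < K. Proof. exact: expR_gt0. Qed.

Let within_le (f : R -> R) t : t <= T -> {within `[0, T], continuous f} ->
  {within `[0, t], continuous f}.
Proof.
move=> tT; apply: continuous_subspaceW => z/=; rewrite !in_itv/= => /andP[-> zt].
exact: le_trans tT.
Qed.

Let sqr_le_norm (a b : R) : a ^+ 2 <= K * b ^+ 2 -> `|a| <= K * `|b|.
Proof.
move=> ab; rewrite -ler_sqr ?nnegrE ?mulr_ge0 ?(ltW K_gt0)// -normrX ger0_norm ?sqr_ge0//.
rewrite exprMn -normrX (ger0_norm (sqr_ge0 b)) (le_trans ab)//.
by rewrite ler_wpM2r ?sqr_ge0// expr2 ler_peMl// ltW.
Qed.

(** X t y - X t z grows and decays at most exponentially, by the two-sided
Gronwall estimate. *)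
Lemma flow_bilipschitz (t y z : R) : 0 <= t <= T ->
  `|X t y - X t z| <= K * `|y - z| /\ `|y - z| <= K * `|X t y - X t z|.
Proof.
move=> /andP[t0 tT].
case: (@gronwall_sqr R (fun s => X s y - X s z) (fun s => U s y - U s z)
    0 L t (lexx _) L0 t0).
- move=> s /andP[s0 st]; have sT : 0 < s < T by rewrite s0 (lt_le_trans st).
  exact: (is_deriveB (dX y sT) (dX z sT)).
- by move=> s /andP[s0 st]; rewrite add0r LU// ltW//= ltW// (lt_le_trans st).
- by apply: (within_le tT) => s; apply: cvgB; exact: cX.
rewrite expr0n/= !addr0 !X0 => h1 h2.
have eK : expR ((1 + 2 * L) * t) <= K.
  by rewrite /flow_growth ler_expR ler_wpM2l// addr_ge0// mulr_ge0.
by split; apply: sqr_le_norm; apply: (le_trans _ (ler_wpM2r (sqr_ge0 _) eK)).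
Qed.

Let flow_neq (t y z : R) : 0 <= t <= T -> y != z -> X t y - X t z != 0.
Proof.
move=> tT yz; have [_] := flow_bilipschitz y z tT.
by apply: contraTneq => ->; rewrite normr0 mulr0 -ltNge normr_gt0 subr_eq0.
Qed.

(** Trajectories that exchange their order would meet, by continuity in time. *)
Lemma flow_increasing (t y z : R) : 0 <= t <= T -> y < z -> X t y < X t z.
Proof.
move=> /andP[t0 tT] yz; rewrite ltNge; apply/negP => le_zy.
case: (@IVT R (fun s => X s z - X s y) 0 t 0 t0).
- by apply: (within_le tT) => s; apply: cvgB; exact: cX.
- rewrite !X0 ge_min le_max !subr_le0 !subr_ge0 le_zy (ltW yz).
  by rewrite orbT.
- move=> s; rewrite in_itv/= => /andP[s0 st] /eqP; apply/negP.
  by apply: flow_neq; [rewrite s0 (le_trans st)|rewrite gt_eqF].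
Qed.

(** The lower Lipschitz bound moves y0 - K and y0 + K at least 1 away from X t y0,
on either side, and the intermediate value theorem fills the gap. *)
Lemma flow_nbhs_surjective (t y0 x : R) : 0 <= t <= T -> `|x - X t y0| < 1 ->
  exists2 y, X t y = x & `|y - y0| <= K * `|x - X t y0|.
Proof.
move=> tT x1.
have cXt : continuous (X t).
  move=> y; apply/cvgrPdist_le => e e0; apply/nbhs_ballP; exists (e / K) => /=.
    by rewrite divr_gt0.
  move=> z; rewrite /ball/= => yz; have [h _] := flow_bilipschitz y z tT.
  by rewrite (le_trans h)// mulrC -ler_pdivlMr// ltW.
have far y : `|y - y0| = K -> 1 <= `|X t y - X t y0|.
  move=> yK; have [_] := flow_bilipschitz y y0 tT.
  by rewrite yK -{1}[K]mulr1 ler_pM2l.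
have up : x <= X t (y0 + K).
  have := far (y0 + K); rewrite addrC addKr gtr0_norm// => /(_ erefl).
  rewrite gtr0_norm; first by move: x1; rewrite ltr_norml => /andP[_]; lra.
  by rewrite subr_gt0 flow_increasing// ltrDl.
have dn : X t (y0 - K) <= x.
  have := far (y0 - K); rewrite addrC addKr normrN gtr0_norm// => /(_ erefl).
  rewrite ltr0_norm; first by move: x1; rewrite ltr_norml => /andP[+ _]; lra.
  by rewrite subr_lt0 flow_increasing// gtrBl.
case: (@IVT R (X t) (y0 - K) (y0 + K) x).
- by have := K_gt0; lra.
- exact: continuous_subspaceT.
- by rewrite ge_min le_max dn up orbT.
- by move=> y _ <-; exists y => //; have [] := flow_bilipschitz y y0 tT.
Qed.

Let Q t y z := (U t y - U t z) / (X t y - X t z).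

Let FQ t y z := (F t (X t y) - F t (X t z)) / (X t y - X t z).

Let Q_le (t y z : R) : 0 <= t <= T -> `|Q t y z| <= L.
Proof.
move=> tT; rewrite /Q; have [->|yz] := eqVneq (X t y - X t z) 0.
  by rewrite invr0 mulr0 normr0.
by rewrite normrM normfV ler_pdivrMr ?normr_gt0// LU.
Qed.

(* the Riccati equation of the velocity quotients *)
Let dQ (t y z : R) : 0 < t < T -> y != z ->
  is_derive t 1 (fun s => Q s y z) (- FQ t y z - Q t y z ^+ 2).
Proof.
move=> tT yz; have tT' : 0 <= t <= T by move: tT => /andP[? ?]; rewrite !ltW.
have D0 := flow_neq tT' yz.
have dD : is_derive t 1 (fun s => X s y - X s z) (U t y - U t z).
  exact: (is_deriveB (dX y tT) (dX z tT)).
have dE : is_derive t 1 (fun s => U s y - U s z) (- F t (X t y) - - F t (X t z)).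
  exact: (is_deriveB (dU y tT) (dU z tT)).
have dV : is_derive t 1 (fun s => (X s y - X s z)^-1)
    (- (X t y - X t z) ^- 2 *: (U t y - U t z)) by exact: (@is_deriveV R (fun s => X s y - X s z) t _ 1 D0 dD).
have dM := is_deriveM dE dV.
apply: (is_derive_eq dM).
by rewrite /GRing.scale/= /Q /FQ; field.
Qed.

Let cQ y z : y != z -> {within `[0, T], continuous (fun s => Q s y z)}.
Proof.
move=> yz; apply/subspace_continuousP => s sT.
have /subspace_continuousP/(_ s sT) cXy := @cX y.
have /subspace_continuousP/(_ s sT) cXz := @cX z.
have /subspace_continuousP/(_ s sT) cUy := @cU y.
have /subspace_continuousP/(_ s sT) cUz := @cU z.
apply: cvgM; first exact: cvgB.
apply: cvgV; first by apply: flow_neq => //; move: sT; rewrite /= in_itv.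
exact: cvgB.
Qed.

(* F t is differentiable with Lipschitz derivative: both follow from the
   quadratic remainder, read from each end of a segment *)
Let FQ_osc (t rho y0 a b c d : R) : 0 < t < T -> 2 * (K * rho) <= 2^-1 ->
  `|a - y0| <= rho -> `|b - y0| <= rho -> `|c - y0| <= rho -> `|d - y0| <= rho ->
  a != b -> c != d -> `|FQ t a b - FQ t c d| <= 8 * C * (K * rho).
Proof.
move=> tT rho2 ha hb hc hd ab cd.
have tT' : 0 <= t <= T by move: tT => /andP[? ?]; rewrite !ltW.
have near2 y z : `|y - y0| <= rho -> `|z - y0| <= rho -> `|X t y - X t z| <= 2 * (K * rho).
  move=> hy hz; have [h _] := flow_bilipschitz y z tT'; rewrite (le_trans h)//.
  rewrite mulrCA ler_pM2l//.
  rewrite -(subrKA y0) (le_trans (ler_normD _ _))//.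
  by rewrite (distrC y0); lra.
have FQG y z : `|y - y0| <= rho -> `|z - y0| <= rho -> y != z ->
    `|FQ t y z - G t (X t z)| <= C * (2 * (K * rho)).
  move=> hy hz yz; have D0 := flow_neq tT' yz.
  have D1 := near2 _ _ hy hz.
  apply: (@le_trans _ _ (C * `|X t y - X t z|)); last by rewrite ler_wpM2l.
  have Dp : 0 < `|X t y - X t z| by rewrite normr_gt0.
  rewrite -(ler_pM2r Dp) -normrM -mulrA -expr2 real_normK ?num_real//.
  have -> : (FQ t y z - G t (X t z)) * (X t y - X t z) =
    F t (X t y) - F t (X t z) - (X t y - X t z) * G t (X t z) by rewrite /FQ; field.
  by rewrite FG// (le_trans D1).
have GG y z : `|y - y0| <= rho -> `|z - y0| <= rho ->
    `|G t (X t y) - G t (X t z)| <= 2 * C * (2 * (K * rho)).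
  move=> hy hz; have [->|yz] := eqVneq y z.
    rewrite subrr normr0 !mulr_ge0 ?(ltW K_gt0)//; exact: le_trans ha.
  have D0 := flow_neq tT' yz.
  have D1 := near2 _ _ hy hz.
  have Dp : 0 < `|X t y - X t z| by rewrite normr_gt0.
  have h1 := FG tT (le_trans D1 rho2).
  rewrite distrC in D1; have h2 := FG tT (le_trans D1 rho2).
  apply: (@le_trans _ _ (2 * C * `|X t z - X t y|)); last by rewrite ler_wpM2l// mulr_ge0.
  rewrite [`|X t z - _|]distrC -(ler_pM2r Dp) -normrM.
  have -> : (G t (X t y) - G t (X t z)) * (X t y - X t z) =
     (F t (X t y) - F t (X t z) - (X t y - X t z) * G t (X t z)) +
     (F t (X t z) - F t (X t y) - (X t z - X t y) * G t (X t y)) by ring.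
  rewrite (le_trans (ler_normD _ _))// -!mulrA -expr2 real_normK ?num_real//.
  by move: h1 h2; rewrite -[X t z - X t y]opprB sqrrN; lra.
have -> : FQ t a b - FQ t c d = (FQ t a b - G t (X t b)) + (G t (X t b) - G t (X t d))
   - (FQ t c d - G t (X t d)) by ring.
rewrite (le_trans (ler_normB _ _))//.
have := ler_normD (FQ t a b - G t (X t b)) (G t (X t b) - G t (X t d)).
have := FQG a b ha hb ab; have := FQG c d hc hd cd; have := GG b d hb hd.
lra.
Qed.

Let Q_osc (t rho y0 a b c d : R) : 0 <= t <= T -> 2 * (K * rho) <= 2^-1 ->
  `|a - y0| <= rho -> `|b - y0| <= rho -> `|c - y0| <= rho -> `|d - y0| <= rho ->
  a != b -> c != d ->
  (Q t a b - Q t c d) ^+ 2 <= expR ((1 + 2 * (2 * L)) * T) *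
    ((Q 0 a b - Q 0 c d) ^+ 2 + (8 * C * (K * rho)) ^+ 2).
Proof.
move=> /andP[t0 tT] rho2 ha hb hc hd ab cd.
have rho0 : 0 <= rho by exact: le_trans ha.
have k0 : 0 <= 8 * C * (K * rho) by rewrite !mulr_ge0// ltW.
have L20 : 0 <= 2 * L by rewrite mulr_ge0.
have inT s : 0 < s < t -> 0 < s < T by move=> /andP[-> st]; exact: (lt_le_trans st).
case: (@gronwall_sqr R (fun s => Q s a b - Q s c d)
  (fun s => (- FQ s a b - Q s a b ^+ 2) - (- FQ s c d - Q s c d ^+ 2))
    (8 * C * (K * rho)) (2 * L) t k0 L20 t0).
- by move=> s /inT sT; exact: (is_deriveB (dQ sT ab) (dQ sT cd)).
- move=> s /inT sT; have sT' : 0 <= s <= T by move: sT => /andP[? ?]; rewrite !ltW.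
  have -> : (- FQ s a b - Q s a b ^+ 2) - (- FQ s c d - Q s c d ^+ 2) =
    - (FQ s a b - FQ s c d) - (Q s a b + Q s c d) * (Q s a b - Q s c d) by ring.
  rewrite (le_trans (ler_normB _ _))// normrN lerD//.
    exact: FQ_osc hd ab cd.
  rewrite normrM ler_wpM2r// (le_trans (ler_normD _ _))//.
  by have := Q_le a b sT'; have := Q_le c d sT'; lra.
- by apply: (within_le tT) => s; apply: cvgB; exact: cQ.
move=> h _; apply: (@le_trans _ _ ((Q t a b - Q t c d) ^+ 2 + (8 * C * (K * rho)) ^+ 2)).
  by rewrite lerDl sqr_ge0.
rewrite (le_trans h)// ler_wpM2r ?addr_ge0 ?sqr_ge0// ler_expR ler_wpM2l//.
by rewrite addr_ge0// mulr_ge0.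
Qed.

(** The velocity quotients of two pairs of particles near y0 stay close if they
are initially: by [Q_osc] the initial gap and the oscillation of the force
quotients, both small near y0, are amplified by a constant factor only. *)
Lemma flow_slopes_cauchy (v : R -> R -> R) (t y0 : R) : 0 <= t <= T ->
  (forall s y, 0 <= s <= T -> U s y = v s (X s y)) ->
  slopes_cauchy (v 0) y0 -> slopes_cauchy (v t) (X t y0).
Proof.
move=> tT Uv S e e0.
set M := expR ((1 + 2 * (2 * L)) * T).
have M0 : 0 < M by exact: expR_gt0.
pose e1 := e / (2 * (M + 1)).
have M1 : 0 < M + 1 by rewrite addr_gt0.
have e10 : 0 < e1 by rewrite divr_gt0// mulr_gt0.
have [r0 r00 r0P] := S e1 e10.
pose rho := Num.min (r0 / 2) (Num.min (4 * K)^-1 (e1 / (8 * (C + 1) * K))).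
have C1 : 0 < C + 1 by rewrite ltr_pwDr.
have rho0 : 0 < rho by rewrite !lt_min !divr_gt0 ?invr_gt0 ?mulr_gt0.
have rho1 : 2 * (K * rho) <= 2^-1.
  have : rho <= (4 * K)^-1 by rewrite /rho !ge_min lexx orbT.
  by rewrite -div1r ler_pdivlMr ?mulr_gt0//; lra.
have rho2 : 8 * C * (K * rho) <= e1.
  have : rho <= e1 / (8 * (C + 1) * K) by rewrite /rho !ge_min lexx !orbT.
  rewrite ler_pdivlMr ?mulr_gt0// => h.
  apply: le_trans h; rewrite [rho * _]mulrC -!mulrA ler_wpM2l//.
  by rewrite ler_wpM2r ?mulr_ge0 ?lerDl ?ltW.
have rhor0 : rho < r0.
  have : rho <= r0 / 2 by rewrite /rho ge_min lexx.
  by lra.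
exists (Num.min 1 (rho / K)).
  by rewrite lt_min ltr01 divr_gt0.
have lift x : `|x - X t y0| < Num.min 1 (rho / K) ->
    exists2 y, X t y = x & `|y - y0| <= rho.
  rewrite lt_min => /andP[x1 xr].
  have [y yx yy0] := flow_nbhs_surjective tT x1.
  exists y => //; rewrite (le_trans yy0)// mulrC -ler_pdivlMr//; exact: ltW.
move=> _ _ _ _ /lift[a <- ha] /lift[b <- hb] /lift[c <- hc] /lift[d <- hd] ab' cd'.
have ab : b != a by apply: contra_neq ab' => ->.
have cd : d != c by apply: contra_neq cd' => ->.
have T00 : 0 <= (0 : R) <= T by rewrite lexx.
have slopeQ (s y z : R) : 0 <= s <= T -> slope (v s) (X s y) (X s z) = Q s z y.
  by move=> sT; rewrite /slope /Q -!Uv.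
rewrite !slopeQ//.
have h := Q_osc tT rho1 hb ha hd hc ab cd.
have h0 : `|Q 0 b a - Q 0 d c| <= e1.
  rewrite -!slopeQ// !X0; apply: r0P; rewrite 1?eq_sym//; exact: le_lt_trans rhor0.
have h0' : (Q 0 b a - Q 0 d c) ^+ 2 <= e1 ^+ 2.
  by rewrite -[leLHS]ger0_norm ?sqr_ge0// normrX ler_sqr ?nnegrE// ltW.
have h1' : (8 * C * (K * rho)) ^+ 2 <= e1 ^+ 2.
  by rewrite ler_sqr ?nnegrE ?(ltW e10)// !mulr_ge0// ltW.
rewrite -ler_sqr ?nnegrE ?(ltW e0)// -normrX ger0_norm ?sqr_ge0//.
apply: (le_trans h).
have -> : e = e1 * (2 * (M + 1)) by rewrite /e1 divfK// gt_eqF// mulr_gt0.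
rewrite -/M.
have : M * ((Q 0 b a - Q 0 d c) ^+ 2 + (8 * C * (K * rho)) ^+ 2) <= M * (e1 ^+ 2 + e1 ^+ 2).
  by rewrite ler_wpM2l ?(ltW M0)// lerD.
move/le_trans; apply.
have : 0 <= e1 ^+ 2 by exact: sqr_ge0.
rewrite [X in _ -> _ <= X]exprMn; move: (e1 ^+ 2) => E E0.
have := mulr_ge0 E0 (ltW M0); have := mulr_ge0 E0 (sqr_ge0 M); lra.
Qed.

End LagrangianFlow.

(** * Smooth cut-offs *)

Section SmoothFunctions.
Context {R : realType}.
Implicit Types (f g : R -> R) (x y : R) (p : {poly R}).

(** Being n times differentiable everywhere, as a recursion on the derivative: this
form is stable under sums and products by a direct induction. *)
Fixpoint Ck (n : nat) f : Prop :=
  if n is m.+1 then (forall x, derivable f x 1) /\ Ck m (derive1 f) else True.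

Lemma CkS n f : Ck n.+1 f -> Ck n f.
Proof.
by elim: n f => //= n IH f [df [ddf Cf]]; split=> //; apply: IH.
Qed.

Lemma derive1_cst (c : R) : derive1 (fun _ : R => c) = (fun=> 0).
Proof. by apply/funext => x; rewrite derive1E derive_cst. Qed.

Lemma Ck_cst n (c : R) : Ck n (fun=> c).
Proof.
elim: n c => //= n IH c; split; first by move=> x; exact: derivable_cst.
by rewrite derive1_cst.
Qed.

Lemma is_derive_derive1 f x : derivable f x 1 -> is_derive x 1 f (derive1 f x).
Proof. by move=> df; rewrite derive1E; exact: derivableP. Qed.

Lemma derive1_is_derive f (df : R -> R) :
  (forall x, is_derive x 1 f (df x)) -> derive1 f = df.
Proof.
by move=> H; apply/funext => x; rewrite derive1E (@derive_val _ _ _ _ _ _ _ (H x)).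
Qed.

Lemma Ck_add n f g : Ck n f -> Ck n g -> Ck n (fun x => f x + g x).
Proof.
elim: n f g => //= n IH f g [df Cf] [dg Cg].
have dfg x : is_derive x 1 (fun x => f x + g x) (derive1 f x + derive1 g x).
  by apply: is_deriveD; exact: is_derive_derive1.
split; first by move=> x; have [] := dfg x.
by rewrite (derive1_is_derive dfg); exact: IH.
Qed.

Lemma Ck_mul n f g : Ck n f -> Ck n g -> Ck n (fun x => f x * g x).
Proof.
elim: n f g => //= n IH f g [df Cf] [dg Cg].
have dfg x : is_derive x 1 (fun x => f x * g x) (f x * derive1 g x + g x * derive1 f x).
  by apply: is_deriveM; exact: is_derive_derive1.
split; first by move=> x; have [] := dfg x.
rewrite (derive1_is_derive dfg).
by apply: Ck_add; apply: IH => //; apply: CkS.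
Qed.

Lemma Ck_inv n f : (forall x, f x != 0) -> Ck n f -> Ck n (fun x => (f x)^-1).
Proof.
move=> f0; elim: n => //= n IH [df Cf].
have dV x : is_derive x 1 (fun x => (f x)^-1) (derive1 f x * ((- 1) * ((f x)^-1 * (f x)^-1))).
  apply: (is_derive_eq (@is_deriveV R f x _ 1 (f0 x) (is_derive_derive1 (df x)))).
  by rewrite /GRing.scale/=; field.
split; first by move=> x; have [] := dV x.
have Cfn : Ck n f by apply: CkS.
rewrite (derive1_is_derive dV); apply: Ck_mul => //; apply: Ck_mul; first exact: Ck_cst.
by apply: Ck_mul; apply: IH.
Qed.

Lemma Ck_affine n f (a b : R) : Ck n f -> Ck n (fun x => f (a * x + b)).
Proof.
elim: n f => //= n IH f [df Cf].
have dc x : is_derive x 1 (fun x => f (a * x + b)) (a * derive1 f (a * x + b)).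
  have h : is_derive x 1 (fun x : R => a * x + b) a.
    by apply: is_derive_eq; rewrite addr0 scaler1.
  rewrite mulrC.
  exact: (@is_derive1_comp _ f (fun x : R => a * x + b) x _ _ (is_derive_derive1 (df _)) h).
split; first by move=> x; have [] := dc x.
rewrite (derive1_is_derive dc); apply: Ck_mul; first exact: Ck_cst.
exact: IH.
Qed.

Lemma Ck_derivable_derive1n f : (forall n, Ck n f) ->
  forall n x, derivable (derive1n n f) x 1.
Proof.
move=> Cf n.
have H m : Ck m.+1 (derive1n n f).
  elim: n m => [m|n IH m]; first by rewrite derive1n0.
  by rewrite derive1nS; have [] := IH m.+1.
by move=> x; have [+ _] := H 0%N; apply.
Qed.

(** From exp(y) = exp(y / m)^m and exp(y / m) >= y / m. *)
Lemma exprn_mul_expRN_le (m : nat) y : 0 < y -> y ^+ m * expR (- y) <= m%:R ^+ m.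
Proof.
move=> y0; case: m => [|m]; first by rewrite !expr0 mul1r -expR0 ler_expR oppr_le0 ltW.
have m0 : (0 : R) < m.+1%:R by [].
have -> : expR (- y) = (expR (- (y / m.+1%:R))) ^+ m.+1.
  by rewrite -expRM_natl mulrN mulrCA divff ?mulr1// gt_eqF.
rewrite -exprMn lerXn2r ?nnegrE ?mulr_ge0 ?expR_ge0 ?(ltW y0)//.
rewrite expRN ler_pdivrMr ?expR_gt0//.
apply: (@le_trans _ _ (m.+1%:R * (1 + y / m.+1%:R))).
  by rewrite mulrDr mulr1 mulrCA divff ?gt_eqF// mulr1 lerDr ltW.
by rewrite ler_pM2l// expR_ge1Dx.
Qed.

Lemma horner_expRN_bounded p : exists2 c : R, 0 <= c &
  forall y, 0 < y -> `|p.[y] * expR (- y)| <= c.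
Proof.
exists (\sum_(i < size p) `|p`_i| * i%:R ^+ i).
  by apply: sumr_ge0 => i _; rewrite mulr_ge0// exprn_ge0.
move=> y y0; rewrite horner_coef mulr_suml (le_trans (ler_norm_sum _ _ _))//.
apply: ler_sum => i _; rewrite -mulrA normrM ler_wpM2l//.
by rewrite ger0_norm ?exprn_mul_expRN_le// mulr_ge0 ?expR_ge0// exprn_ge0// ltW.
Qed.

(** The functions p(1/x) exp(-1/x), extended by 0, form a family that contains the
classical flat function and is stable under differentiation; for that reason
all its members are smooth. *)
Definition flat p x := if 0 < x then p.[x^-1] * expR (- x^-1) else 0.

Lemma is_derive_flat p x : is_derive x 1 (flat p) (flat ('X^2 * (p - deriv p)) x).
Proof.
have [x0|x0|->] := ltgtP x 0.
- have -> : flat ('X^2 * (p - deriv p)) x = 0 by rewrite /flat ltNge ltW.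
  suff E : \near x, 0 = flat p x by exact: near_eq_is_derive E (is_derive_cst 0 x 1).
  near=> z; rewrite /flat ltNge.
  suff -> : z <= 0 by [].
  by near: z; apply: filterS (lt_nbhsl x0) => z /ltW.
- have -> : flat ('X^2 * (p - deriv p)) x =
      ('X^2 * (p - deriv p)).[x^-1] * expR (- x^-1) by rewrite /flat x0.
  have E : \forall z \near x, p.[z^-1] * expR (- z^-1) = flat p z.
    near=> z; rewrite /flat; suff -> : 0 < z by [].
    by near: z; exact: lt_nbhsr.
  apply: near_eq_is_derive E _.
  have xn : x != 0 by rewrite gt_eqF.
  have dV : is_derive x 1 (fun z : R => z^-1) (- x ^- 2).
    by apply: (is_derive_eq (@is_deriveV R id x _ 1 xn (is_derive_id _ _))); rewrite scaler1.
  have dp : is_derive x 1 (fun z => p.[z^-1]) ((deriv p).[x^-1] * - x ^- 2).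
    exact: (@is_derive1_comp _ (horner p) (fun z => z^-1) x _ _ (is_derive_poly _ _) dV).
  have dN : is_derive x 1 (fun z : R => - z^-1) (x ^- 2).
    by apply: (is_derive_eq (is_deriveN dV)); rewrite opprK.
  have de : is_derive x 1 (fun z => expR (- z^-1)) (expR (- x^-1) * x ^- 2).
    exact: (@is_derive1_comp _ expR (fun z => - z^-1) x _ _ (is_derive_expR _) dN).
  apply: (is_derive_eq (is_deriveM dp de)).
  by rewrite /GRing.scale/= hornerM hornerXn hornerD hornerN; field.
- have flat0 q : flat q 0 = 0 by rewrite /flat ltxx.
  rewrite flat0.
  have [c c0 cP] := horner_expRN_bounded ('X^2 * p).
  apply/is_derive_epsP => e e0; exists (e / (c + 1)).
    by rewrite divr_gt0// ltr_pwDr.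
  move=> s; rewrite subr0 mulr0 subr0 flat0 subr0 => se.
  rewrite /flat; case: ifPn => s0; last by rewrite normr0 mulr_ge0// ltW.
  have := cP s^-1; rewrite invr_gt0 hornerM hornerXn => /(_ s0) h.
  apply: (@le_trans _ _ (c * s ^+ 2)).
    rewrite -ler_pdivrMr ?exprn_gt0// -[s ^+ 2]gtr0_norm ?exprn_gt0//.
    by rewrite -normfV -normrM mulrC mulrA -exprVn.
  rewrite (gtr0_norm s0) in se *.
  rewrite expr2 mulrA ler_wpM2r ?(ltW s0)//.
  move: se; rewrite ltr_pdivlMr ?ltr_pwDr// => /ltW; apply: le_trans.
  by rewrite mulrC ler_wpM2l ?(ltW s0)// lerDl.
Unshelve. all: by end_near. Qed.

Lemma Ck_flat n p : Ck n (flat p).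
Proof.
elim: n p => //= n IH p; split; first by move=> x; have [] := is_derive_flat p x.
by rewrite (derive1_is_derive (is_derive_flat p)).
Qed.

(** With e the flat function of exp(-1/x), the quotient e(x) / (e(x) + e(1 - x))
is smooth, 0 for x <= 0 and 1 for x >= 1. *)
Definition smooth_step x :=
  flat 1 x * (flat 1 x + flat 1 ((-1) * x + 1))^-1.

Lemma flat1_ge0 x : 0 <= flat 1 x.
Proof. by rewrite /flat; case: ifP => // _; rewrite hornerE mul1r expR_ge0. Qed.

Lemma flat1_gt0 x : 0 < x -> 0 < flat 1 x.
Proof. by rewrite /flat => ->; rewrite hornerE mul1r expR_gt0. Qed.

Lemma flat1_le0 x : x <= 0 -> flat 1 x = 0.
Proof. by rewrite /flat ltNge => ->. Qed.

Lemma smooth_step_den_gt0 x : 0 < flat 1 x + flat 1 ((-1) * x + 1).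
Proof.
have [x0|x0] := ltP 0 x; first by rewrite ltr_pwDl ?flat1_gt0 ?flat1_ge0.
by rewrite ltr_wpDl ?flat1_ge0 ?flat1_gt0//; lra.
Qed.

Lemma Ck_smooth_step n : Ck n smooth_step.
Proof.
apply: Ck_mul; first exact: Ck_flat.
apply: Ck_inv; first by move=> x; rewrite gt_eqF// smooth_step_den_gt0.
by apply: Ck_add; [exact: Ck_flat|apply: Ck_affine; exact: Ck_flat].
Qed.

Lemma smooth_step_le0 x : x <= 0 -> smooth_step x = 0.
Proof. by move=> x0; rewrite /smooth_step flat1_le0// mul0r. Qed.

Lemma smooth_step_ge1 x : 1 <= x -> smooth_step x = 1.
Proof.
move=> x1; rewrite /smooth_step (@flat1_le0 (-1 * x + 1)); last by lra.
by rewrite addr0 divff// gt_eqF// flat1_gt0//; lra.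
Qed.

Lemma smooth_step_itv x : 0 <= smooth_step x <= 1.
Proof.
rewrite /smooth_step divr_ge0 ?flat1_ge0 ?(ltW (smooth_step_den_gt0 _))//=.
by rewrite ler_pdivrMr ?smooth_step_den_gt0// mul1r lerDl flat1_ge0.
Qed.

End SmoothFunctions.

(** * Integrals over bounded intervals *)

Section IntegralsOverIntervals.
Context {R : realType}.
Local Notation mu := (@lebesgue_measure R).
Implicit Types (f g : R -> R) (a b c x y : R).

Lemma lebesgue_measure_itvcc a b : a <= b -> mu `[a, b] = (b - a)%:E.
Proof.
rewrite le_eqVlt => /predU1P[->|ab]; last by rewrite lebesgue_measure_itv/= lte_fin ab.
by rewrite set_itv1 lebesgue_measure_set1 subrr.
Qed.

Lemma locally_integrable_itv g a b :
  locally_integrable setT g -> mu.-integrable `[a, b] (EFin \o g).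
Proof.
move=> [mg _ ig]; apply/integrableP; split.
  by apply/measurable_EFinP; exact: measurable_funTS.
by apply: ig => //; exact: segment_compact.
Qed.

Lemma bounded_locally_integrable g (M : R) : measurable_fun setT g ->
  (forall x, `|g x| <= M) -> locally_integrable setT g.
Proof.
move=> mg gM; split => //; first exact: openT.
move=> K _ cK; apply: (@le_lt_trans _ _ (\int[mu]_(x in K) M%:E)%E).
  apply: ge0_le_integral => //=.
  - exact: compact_measurable.
  - by apply/measurable_EFinP; apply: measurableT_comp => //; exact: measurable_funTS.
  - by move=> x _; rewrite lee_fin.
rewrite integral_cst; last exact: compact_measurable.
have := compact_finite_measure cK.
rewrite -ge0_fin_numE// => /fineK <-.
by rewrite -EFinM ltry.
Qed.

Lemma continuous_locally_integrable f : continuous f -> locally_integrable setT f.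
Proof.
move=> cf; split; [exact: continuous_measurable_fun|exact: openT|].
move=> K _ cK.
by have /integrableP[] := continuous_compact_integrable cK (continuous_subspaceT cf).
Qed.

Lemma Rintegral_le_bound f a b (M : R) : a <= b ->
  mu.-integrable `[a, b] (EFin \o f) ->
  (forall x, a <= x <= b -> `|f x| <= M) ->
  `|\int[mu]_(x in `[a, b]) f x| <= M * (b - a).
Proof.
move=> ab fi fM; rewrite (le_trans (le_normr_Rintegral _ _))//.
have -> : M * (b - a) = \int[mu]_(x in `[a, b]) M.
  by rewrite Rintegral_cst//= lebesgue_measure_itvcc.
apply: le_Rintegral => //.
- exact: integrable_norm.
- apply: locally_integrable_itv; apply: continuous_locally_integrable.
  by move=> x; exact: cvg_cst.
Qed.

Lemma Rintegral_split f a b c : a <= c -> c <= b ->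
  mu.-integrable `[a, b] (EFin \o f) ->
  \int[mu]_(x in `[a, b]) f x =
  \int[mu]_(x in `[a, c]) f x + \int[mu]_(x in `[c, b]) f x.
Proof.
move=> ac cb fi.
have := Rintegral_itvB fi; move=> /(_ c); rewrite !bnd_simp => /(_ ac cb).
rewrite Rintegral_itv_obnd_cbnd; last first.
  apply: integrableS fi => //; apply: subset_itv; rewrite ?bnd_simp//.
by move=> <-; rewrite addrC subrK.
Qed.

Lemma Rintegral_support (A B : set R) f : B `<=` A ->
  (forall x, A x -> ~ B x -> f x = 0) ->
  \int[mu]_(x in A) f x = \int[mu]_(x in B) f x.
Proof.
move=> BA f0; rewrite Rintegral_mkcond [RHS]Rintegral_mkcond.
congr (Rintegral _ _ _); apply/funext => x; rewrite !patchE.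
case: ifPn => [|/negP]; rewrite inE => Ax; case: ifPn => [|/negP]; rewrite inE// => Bx.
- exact: f0.
- by exfalso; apply: Ax; exact: BA.
Qed.

Lemma Rintegral_ae_eq (A : set R) f g : measurable A ->
  measurable_fun A f -> measurable_fun A g ->
  {ae mu, forall x, A x -> f x = g x} ->
  \int[mu]_(x in A) f x = \int[mu]_(x in A) g x.
Proof.
move=> mA mf mg fg; rewrite /Rintegral; congr fine.
apply: ae_eq_integral => //; [exact/measurable_EFinP..|].
move: fg; apply: filterS; first exact: (ae_filter_ringOfSetsType mu).
by move=> x H /H/= ->.
Qed.

End IntegralsOverIntervals.

(** * Weak derivatives of continuous functions *)

Section WeakDerivatives.
Context {R : realType}.
Local Notation mu := (@lebesgue_measure R).
Implicit Types (f g : R -> R) (a b c x y : R).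

Let S := @smooth_step R.
Let k := derive1 S.

Let dS x : is_derive x 1 S (k x).
Proof. by apply: is_derive_derive1; have [+ _] := Ck_smooth_step (R := R) 1; apply. Qed.

Let ck : continuous k.
Proof.
move=> x; have [_ [+ _]] := Ck_smooth_step (R := R) 2.
by move=> /(_ x) /derivable1_diffP/differentiable_continuous.
Qed.

Let k_out x : x < 0 \/ 1 < x -> k x = 0.
Proof.
move=> x01; rewrite /k derive1E; apply: derive_val.
case: x01 => x01.
- have E : \forall z \near x, 0 = S z.
    by apply: filterS (lt_nbhsl x01) => z z0; rewrite /S smooth_step_le0 ?(ltW z0).
  have D := is_derive_cst (0 : R) x (1 : R).
  exact: near_eq_is_derive E D.
- have E : \forall z \near x, 1 = S z.
    by apply: filterS (lt_nbhsr x01) => z z0; rewrite /S smooth_step_ge1 ?(ltW z0).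
  have D := is_derive_cst (1 : R) x (1 : R).
  exact: near_eq_is_derive E D.
Qed.

Let k_bounded : exists2 M : R, 0 < M & forall x, `|k x| <= M.
Proof.
have cn : {within `[(0 : R), 1], continuous (fun x => `|k x|)}.
  apply: continuous_subspaceT => x.
  by apply: (@continuous_comp _ _ _ k); [exact: ck|exact: norm_continuous].
have [c _ cM] := EVT_max ler01 cn.
exists (`|k c| + 1); first by rewrite ltr_wpDl.
move=> x; have [x01|] := boolP (x \in `[0, 1]); first by rewrite (le_trans (cM x x01))// lerDl.
rewrite in_itv/= negb_and -!ltNge => /orP x01.
by rewrite k_out// normr0 addr_ge0.
Qed.

Let step n c x := S (n.+1%:R * x + - (n.+1%:R * c)).
Let dstep n c x := n.+1%:R * k (n.+1%:R * x + - (n.+1%:R * c)).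

Let step_le n c x : x <= c -> step n c x = 0.
Proof. by move=> xc; rewrite /step /S smooth_step_le0// subr_le0 ler_pM2l. Qed.

Let step_ge n c x : c + n.+1%:R^-1 <= x -> step n c x = 1.
Proof.
move=> xc; rewrite /step /S smooth_step_ge1// -mulrBr mulrC -ler_pdivrMr//.
by rewrite div1r lerBrDl.
Qed.

Let is_derive_step n c x : is_derive x 1 (step n c) (dstep n c x).
Proof.
have h : is_derive x 1 (fun x : R => n.+1%:R * x + - (n.+1%:R * c)) n.+1%:R.
  by apply: is_derive_eq; rewrite ?oppr0 addr0 scaler1.
rewrite /dstep mulrC.
exact: (@is_derive1_comp _ S (fun x : R => n.+1%:R * x + - (n.+1%:R * c)) x _ _ (dS _) h).
Qed.

Let continuous_dstep n c : continuous (dstep n c).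
Proof.
move=> x; apply: cvgM; first exact: cvg_cst.
apply: (@continuous_comp _ _ _ (fun x => n.+1%:R * x + - (n.+1%:R * c)) k); last exact: ck.
apply: cvgD; last exact: cvg_cst.
exact: mulrl_continuous.
Qed.

Let dstep_out n c x : ~ (c <= x <= c + n.+1%:R^-1) -> dstep n c x = 0.
Proof.
move=> /negP; rewrite negb_and -!ltNge => /orP xc; rewrite /dstep k_out ?mulr0//.
rewrite -mulrBr; case: xc => xc; [left|right].
  by rewrite pmulr_rlt0// subr_lt0.
by rewrite mulrC -ltr_pdivrMr// div1r ltrBrDl.
Qed.

Let dstep_total n c :
  \int[mu]_(x in `[c, c + n.+1%:R^-1]) dstep n c x = 1.
Proof.
rewrite /Rintegral (@continuous_FTC2 _ (dstep n c) (step n c)).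
- by rewrite step_ge// step_le// sube0.
- by rewrite ltrDl invr_gt0.
- exact: continuous_subspaceT.
- have cs : continuous (step n c).
    move=> x; have [+ _] := is_derive_step n c x.
    by move=> /derivable1_diffP/differentiable_continuous.
  split; first by move=> x _; have [] := is_derive_step n c x.
  + by apply: cvg_at_right_filter; exact: cs.
  + by apply: cvg_at_left_filter; exact: cs.
- by move=> x _; rewrite (derive1_is_derive (is_derive_step n c)).
Qed.

Let integrable_mul_dstep f n c a b : continuous f ->
  mu.-integrable `[a, b] (EFin \o (fun x => f x * dstep n c x)).
Proof.
move=> cf; apply: locally_integrable_itv; apply: continuous_locally_integrable => x.
by apply: cvgM; [exact: cf|exact: continuous_dstep].
Qed.

(* the derivatives of the steps are an approximation of the identity, not
   necessarily nonnegative: the L^1 norms are bounded by the constant M *)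
Let dstep_cvg f c : continuous f ->
  \int[mu]_x (f x * dstep n c x) @[n --> \oo] --> f c.
Proof.
move=> cf; have [M M0 kM] := k_bounded.
have restr n : \int[mu]_x (f x * dstep n c x) =
    \int[mu]_(x in `[c, c + n.+1%:R^-1]) (f x * dstep n c x).
  apply: Rintegral_support => // x _; rewrite /= in_itv/= => xc.
  by rewrite dstep_out ?mulr0.
apply/cvgrPdist_le => e e0.
have : 0 < e / M by rewrite divr_gt0.
move: (cf c) => /cvgrPdist_le/[apply] /nbhs_ballP[r /= r0 rP].
near=> n; rewrite restr.
have nr : n.+1%:R^-1 < r by near: n; exact: near_infty_natSinv_lt (PosNum r0).
have ncc : c <= c + n.+1%:R^-1 by rewrite lerDl.
have -> : f c = \int[mu]_(x in `[c, c + n.+1%:R^-1]) (f c * dstep n c x).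
  rewrite RintegralZl ?dstep_total ?mulr1//.
  by apply: locally_integrable_itv; apply: continuous_locally_integrable; exact: continuous_dstep.
rewrite -RintegralB//; last 2 first.
- by apply: (@integrable_mul_dstep (fun=> f c)) => x; exact: cvg_cst.
- exact: integrable_mul_dstep.
under eq_Rintegral do rewrite -mulrBl.
apply: le_trans (@Rintegral_le_bound _ _ _ _ (e * n.+1%:R) ncc _ _) _.
- apply: (@integrable_mul_dstep (fun x => f c - f x)) => x.
  by apply: cvgB; [exact: cvg_cst|exact: cf].
- move=> x /andP[cx xc]; rewrite /dstep [n.+1%:R * _]mulrC mulrA normrM [X in _ * X]gtr0_norm//.
  rewrite ler_pM2r// normrM -[e](@divfK _ M) ?gt_eqF// ler_pM//.
  apply: rP; rewrite /ball/= distrC ger0_norm ?subr_ge0//.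
  by rewrite ltrBlDl (le_lt_trans xc)// ltrD2l.
- by rewrite addrC addKr mulfK.
Unshelve. all: by end_near. Qed.

(* a test function that converges to the indicator of ]a, b] and whose
   derivative converges to the difference of the Dirac masses at a and b *)
Let cutoff n a b x := step n a x - step n b x.

Let cutoff_test n a b : a < b -> test_function (cutoff n a b).
Proof.
move=> ab; split.
- apply: Ck_derivable_derive1n => m.
  have Cs c : Ck m (step n c) by apply: (Ck_affine (f := S)); exact: Ck_smooth_step.
  have -> : cutoff n a b = (fun x => step n a x + (-1) * step n b x).
    by apply/funext => x; rewrite /cutoff mulN1r.
  by apply: Ck_add => //; apply: Ck_mul => //; exact: Ck_cst.
- exists (`|a| + `|b| + 1) => x xab.
  have n1 : n.+1%:R^-1 <= 1 :> R by rewrite invf_le1 ?ler1n ?ltr0n.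
  have [x0|x0] := leP x 0.
    have xa : x <= a.
      by move: xab (ler_norm (- a)) (normr_ge0 b); rewrite (ler0_norm x0) normrN; lra.
    by rewrite /cutoff !step_le ?subrr// (le_trans xa)// ltW.
  have xb : b + 1 <= x.
    by move: xab (ler_norm b) (normr_ge0 a); rewrite (gtr0_norm x0); lra.
  by rewrite /cutoff !step_ge ?subrr//; move: n1; set z := _^-1; lra.
Qed.

Let derive1_cutoff n a b : derive1 (cutoff n a b) = (fun x => dstep n a x - dstep n b x).
Proof.
apply: derive1_is_derive => x.
by apply: is_deriveB; exact: is_derive_step.
Qed.

Let integral_mul_derive1_cutoff f n a b : continuous f -> a < b ->
  \int[mu]_x (f x * derive1 (cutoff n a b) x) =
  \int[mu]_x (f x * dstep n a x) - \int[mu]_x (f x * dstep n b x).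
Proof.
move=> cf ab.
have n1 : n.+1%:R^-1 <= 1 :> R by rewrite invf_le1 ?ler1n ?ltr0n.
have supp c : a <= c <= b -> \int[mu]_x (f x * dstep n c x) =
    \int[mu]_(x in `[a, b + 1]) (f x * dstep n c x).
  move=> /andP[ac cb]; apply: Rintegral_support => // x _; rewrite /= in_itv/= => xc.
  rewrite dstep_out ?mulr0//; move: n1; set z := _^-1 => n1 /andP[? ?].
  by apply: xc; apply/andP; split; lra.
rewrite !supp ?lexx ?(ltW ab)// -RintegralB//; [|exact: integrable_mul_dstep..].
rewrite derive1_cutoff.
have -> : \int[mu]_x (f x * (dstep n a x - dstep n b x)) =
   \int[mu]_(x in `[a, b + 1]) (f x * (dstep n a x - dstep n b x)).
  apply: Rintegral_support => // x _; rewrite /= in_itv/= => xc.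
  by rewrite !dstep_out ?subrr ?mulr0//; move: n1; set z := _^-1 => n1 /andP[? ?];
    apply: xc; apply/andP; split; lra.
by apply: eq_Rintegral => x _; rewrite mulrBr.
Qed.

Let cutoff_cvg g a b : locally_integrable setT g -> a < b ->
  \int[mu]_x (g x * cutoff n a b x) @[n --> \oo] --> \int[mu]_(x in `[a, b]) g x.
Proof.
move=> ig ab.
have supp n : \int[mu]_x (g x * cutoff n a b x) =
    \int[mu]_(x in `[a, b + 1]) (g x * cutoff n a b x).
  have n1 : n.+1%:R^-1 <= 1 :> R by rewrite invf_le1 ?ler1n ?ltr0n.
  apply: Rintegral_support => // x _; rewrite /= in_itv/= => /negP.
  rewrite negb_and -!ltNge /cutoff => /orP[xa|xb].
    by rewrite !step_le ?subrr ?mulr0//; lra.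
  by rewrite !step_ge ?subrr ?mulr0//; move: n1; set z := _^-1; lra.
under eq_fun do rewrite supp.
have -> : \int[mu]_(x in `[a, b]) g x =
    \int[mu]_(x in `[a, b + 1]) (g x * \1_(`]a, b]) x).
  have -> : \int[mu]_(x in `[a, b]) g x = \int[mu]_(x in `]a, b]) g x.
    rewrite Rintegral_itv_obnd_cbnd//.
    apply: integrableS (locally_integrable_itv a b ig) => //.
    by apply: subset_itv; rewrite ?bnd_simp.
  rewrite [RHS](@Rintegral_support _ _ `]a, b]); first last.
  - by move=> x _ xab; rewrite indicE memNset ?mulr0.
  - by apply: subset_itv; rewrite ?bnd_simp// ler_wpDr.
  by apply: eq_Rintegral => x xab; rewrite indicE xab mulr1.
have mg := ig; case: mg => mg _ _.
have mstep n c : measurable_fun setT (step n c).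
  apply: continuous_measurable_fun => x; have [+ _] := is_derive_step n c x.
  by move=> /derivable1_diffP/differentiable_continuous.
have step_lim c x : (fun n => step n c x) @ \oo --> ((c < x)%R%:R : R).
  have [xc|cx] := leP x c.
    by under eq_fun do rewrite step_le//; exact: cvg_cst.
  apply: cvg_near_cst; near=> n; rewrite step_ge// -lerBrDl.
  apply: ltW; near: n; have xc0 : 0 < x - c by rewrite subr_gt0.
  exact: near_infty_natSinv_lt (PosNum xc0).
pose h x := g x * \1_(`]a, b]) x.
pose h_ n x := g x * cutoff n a b x.
have mh_ n : measurable_fun `[a, b + 1] (EFin \o h_ n).
  apply/measurable_EFinP; apply: measurable_funTS; apply: measurable_funM => //.
  by apply: measurable_funB; exact: mstep.
have mh : measurable_fun `[a, b + 1] (EFin \o h).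
  by apply/measurable_EFinP; apply: measurable_funTS; apply: measurable_funM.
have h_h : {ae mu, forall x, `[a, b + 1]%classic x ->
    (fun n => (EFin \o h_ n) x) @ \oo --> (EFin \o h) x}.
  apply: aeW => x _; apply: cvg_EFin; first exact: nearW.
  apply: cvgM; first exact: cvg_cst.
  have -> : \1_(`]a, b]) x = (a < x)%R%:R - (b < x)%R%:R :> R.
    rewrite indicE mem_setE in_itv/=; case: (ltP a x) => ax /=.
      by case: (leP x b); rewrite ?subr0 ?subrr.
    by rewrite ltNge (le_trans ax (ltW ab)) subr0.
  by apply: cvgB; exact: step_lim.
have dom : {ae mu, forall x n, `[a, b + 1]%classic x ->
    (`|(EFin \o h_ n) x| <= (EFin \o (fun x => `|g x|)%R) x)%E}.
  apply: aeW => x n _ /=; rewrite lee_fin normrM ler_piMr//.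
  rewrite /cutoff /step.
  have /andP[? ?] := smooth_step_itv (n.+1%:R * x + - (n.+1%:R * a)).
  have /andP[? ?] := smooth_step_itv (n.+1%:R * x + - (n.+1%:R * b)).
  by rewrite ler_norml; apply/andP; split; rewrite /S; lra.
have ig' := integrable_norm (locally_integrable_itv a (b + 1) ig).
have mab : measurable `[a, b + 1]%classic by [].
have [ih _ ih_h] := @dominated_convergence _ _ R mu _ mab
  (fun n => EFin \o h_ n) (EFin \o h) (EFin \o (fun x => `|g x|)) mh_ mh h_h ig' dom.
apply: fine_cvg; rewrite fineK//; exact: integrable_fin_num ih.
Unshelve. all: by end_near. Qed.

(** The fundamental theorem of calculus for a weak derivative (du Bois-Reymond):
test the definition with smooth approximations of the indicator of [a, b]. *)
Lemma weak_deriv_FTC f g a b : continuous f -> is_weak_deriv f g -> a < b ->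
  f b - f a = \int[mu]_(x in `[a, b]) g x.
Proof.
move=> cf [_ ig fg] ab.
have h1 : \int[mu]_x (f x * derive1 (cutoff n a b) x) @[n --> \oo] --> f a - f b.
  under eq_fun do rewrite (integral_mul_derive1_cutoff _ cf ab).
  by apply: cvgB; exact: dstep_cvg.
have h2 : \int[mu]_x (f x * derive1 (cutoff n a b) x) @[n --> \oo] -->
    - \int[mu]_(x in `[a, b]) g x.
  under eq_fun do rewrite (fg _ (cutoff_test _ ab)).
  by apply: cvgN; exact: cutoff_cvg.
rewrite -[LHS]opprK opprB; apply/eqP; rewrite eqr_oppLR; apply/eqP.
exact: cvg_unique h1 h2.
Qed.

End WeakDerivatives.

(** * Bounded weak derivatives *)

Section BoundedWeakDerivative.
Context {R : realType}.
Local Notation mu := (@lebesgue_measure R).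
Implicit Types (f g : R -> R) (a b c x y : R).

Lemma ae_itv_witness (P : R -> Prop) a b : a < b -> {ae mu, forall x, P x} ->
  exists2 x, a < x < b & P x.
Proof.
move=> ab [N [mN N0 PN]]; apply: contrapT => H.
have sub : `]a, b[%classic `<=` N.
  move=> x; rewrite /= in_itv/= => xab; apply: PN => /= Px.
  by apply: H; exists x.
have : (mu `]a, b[ <= mu N)%E by apply: le_measure; rewrite ?inE.
by rewrite N0 lebesgue_measure_itv/= lte_fin ab lee_fin subr_le0 leNgt ab.
Qed.

Lemma ae_le_continuous f (M : R) : continuous f ->
  {ae mu, forall x, `|f x| <= M} -> forall x, `|f x| <= M.
Proof.
move=> cf fM x; apply/ler_addgt0Pr => e e0.
have /cvgrPdist_le/(_ e e0)/nbhs_ballP[r /= r0 rP] := cf x.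
have xr : x < x + r by rewrite ltrDl.
have [y /andP[xy yr] fy] := ae_itv_witness xr fM.
have := rP y; rewrite /ball/= ltr0_norm ?subr_lt0// opprB ltrBlDl => /(_ yr) fxy.
by rewrite -[f x](subrK (f y)) (le_trans (ler_normD _ _))// addrC lerD.
Qed.

(** At a Lebesgue point, g is the derivative of its primitive, which is
Lipschitz. *)
Lemma ae_bounded_of_itv g (L : R) : locally_integrable setT g ->
  (forall a b, a < b -> `|\int[mu]_(x in `[a, b]) g x| <= L * (b - a)) ->
  {ae mu, forall x, `|g x| <= L}.
Proof.
move=> ig gL; have := lebesgue_differentiation ig.
apply: filterS; first exact: (ae_filter_ringOfSetsType mu).
move=> x lx.
have x1 : x < x + 1 by rewrite ltrDl.
have ax : (BLeft (x - 1)%R < BRight x)%E by rewrite lte_fin; lra.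
have [dF <-] := @FTC1_lebesgue_pt R g (BLeft (x - 1)) x (x + 1) x1
  (locally_integrable_itv _ _ ig) ax lx.
set F := fun y => _ in dF *.
apply/ler_addgt0Pr => e e0.
have /is_derive_epsP/(_ e e0)[r r0 rP] := is_derive_derive1 dF.
pose s := x + r / 2.
have r20 : 0 < r / 2 by rewrite divr_gt0.
have sx : `|s - x| = r / 2 by rewrite /s addrC addKr gtr0_norm.
have := rP s; rewrite sx => /(_ _) h.
have {}h : `|F s - F x - (s - x) * derive1 F x| <= e * (r / 2) by apply: h; lra.
have xs : x < s by rewrite ltrDl.
have Fs : F s - F x = \int[mu]_(x in `[x, s]) g x.
  rewrite /F (@Rintegral_split _ g (x - 1) s x) ?(ltW xs)//.
  - by rewrite addrC addKr.
  - by lra.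
  - exact: locally_integrable_itv.
have := gL _ _ xs; rewrite -Fs => h2.
have : `|(s - x) * derive1 F x| <= (L + e) * (s - x).
  have -> : (s - x) * derive1 F x = (F s - F x) - (F s - F x - (s - x) * derive1 F x) by ring.
  rewrite (le_trans (ler_normB _ _))// [X in _ <= X]mulrDl lerD//.
  by have E : s - x = r / 2; [rewrite /s addrC addKr|move: h; rewrite E].
by rewrite normrM gtr0_norm ?subr_gt0// mulrC ler_pM2r// subr_gt0.
Qed.

(** Truncation gives a representative that is bounded everywhere, so that its
integrals can be estimated pointwise. *)
Lemma ae_bounded_representative g (L : R) : 0 <= L -> measurable_fun setT g ->
  {ae mu, forall x, `|g x| <= L} ->
  exists h : R -> R, [/\ measurable_fun setT h, forall x, `|h x| <= L &
    {ae mu, forall x, g x = h x}].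
Proof.
move=> L0 mg gL; exists (fun z => if `|g z| <= L then g z else 0); split.
- apply: measurable_fun_ifT => //.
  by apply: measurable_fun_ler => //; exact: measurableT_comp.
- by move=> z; case: ifP => // _; rewrite normr0.
- move: gL; apply: filterS; first exact: (ae_filter_ringOfSetsType mu).
  by move=> z ->.
Qed.

Lemma weak_derivP f : is_weak_deriv f (weak_deriv f) \/ weak_deriv f = cst 0.
Proof.
rewrite /weak_deriv; have [[g fg]|H] := pselect (exists g, is_weak_deriv f g).
  by left; exact: (xgetPex (cst 0) (ex_intro _ g fg)).
by right; apply: xgetPN => g fg; apply: H; exists g.
Qed.

(** The total function [weak_deriv] takes the value 0 on functions without a weak
derivative, and 0 obeys the bound too; there is thus nothing to prove about the
existence of the weak derivative of a Lipschitz function. *)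
Lemma weak_deriv_of_lipschitz f (L : R) : continuous f ->
  (forall x y, `|f x - f y| <= L * `|x - y|) ->
  locally_integrable setT (weak_deriv f) /\
  {ae mu, forall x, `|weak_deriv f x| <= L}.
Proof.
move=> cf fL; have L0 : 0 <= L.
  by have := fL 1 0; rewrite subr0 normr1 mulr1; exact: le_trans.
have [fg|->] := weak_derivP f; last first.
  split; last by apply: aeW => x; rewrite normr0.
  by apply: (@bounded_locally_integrable _ _ 0) => // x; rewrite normr0.
have ig : locally_integrable setT (weak_deriv f) by case: fg.
split=> //; apply: ae_bounded_of_itv => // a b ab.
rewrite -(weak_deriv_FTC cf fg ab) (le_trans (fL _ _))//.
by rewrite gtr0_norm ?subr_gt0.
Qed.

Lemma Lp_normy_le f (M : R) : (Lp_norm +oo%E f <= M%:E)%E -> {ae mu, forall x, `|f x| <= M}.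
Proof.
have muT : (0 < mu [set: R])%E.
  apply: (@lt_le_trans _ _ (mu `[(0 : R), 1])); last by apply: le_measure; rewrite ?inE.
  by rewrite lebesgue_measure_itvcc// subr0 lte_fin.
rewrite /Lp_norm unlock ifT; last exact: muT.
by move=> /ess_supP; apply: filterS => x; rewrite /= lee_fin.
Qed.

Lemma Lp_norm_ge0 p f : (0 <= Lp_norm p f)%E.
Proof. exact: Lnorm_ge0. Qed.

Lemma W1infty_lipschitz f (M : R) : continuous f -> W1 +oo%E f ->
  (W1_norm +oo%E f <= M%:E)%E ->
  (forall x, `|f x| <= M) /\ (forall x y, `|f x - f y| <= M * `|x - y|).
Proof.
move=> cf [[g fg] _ _] fM.
have f1 : (Lp_norm +oo%E f <= M%:E)%E.
  by apply: le_trans fM; rewrite leeDl// Lp_norm_ge0.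
have f2 : (Lp_norm +oo%E (weak_deriv f) <= M%:E)%E.
  by apply: le_trans fM; rewrite leeDr// Lp_norm_ge0.
have dM := Lp_normy_le f2.
have M0 : 0 <= M.
  have [x _ xM] := ae_itv_witness (ltr01 : (0 : R) < 1) dM.
  exact: le_trans xM.
split; first by apply: ae_le_continuous => //; exact: Lp_normy_le.
have wf : is_weak_deriv f (weak_deriv f) by exact: (xgetPex (cst 0) (ex_intro _ g fg)).
have [_ iw _] := wf.
have lt_case x y : x < y -> `|f y - f x| <= M * (y - x).
  move=> xy; rewrite (weak_deriv_FTC cf wf xy).
  have [miw _ _] := iw.
  have [h [mh hM wh]] := ae_bounded_representative M0 miw dM.
  rewrite (@Rintegral_ae_eq _ `[x, y] _ h)//.
  - apply: Rintegral_le_bound => //; first exact: ltW.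
    exact/locally_integrable_itv/(bounded_locally_integrable mh hM).
  - exact: measurable_funTS.
  - exact: measurable_funTS.
  - move: wh; apply: filterS; first exact: (ae_filter_ringOfSetsType mu).
    by move=> z ->.
move=> x y; have [xy|yx|->] := ltgtP x y.
- rewrite distrC (le_trans (lt_case _ _ xy))// distrC gtr0_norm ?subr_gt0//.
- by rewrite (le_trans (lt_case _ _ yx))// gtr0_norm ?subr_gt0.
- by rewrite !subrr normr0 mulr0.
Qed.

(** Cauchy-Schwarz against the indicator of [a, b], whose L^2 norm is at most 1
because the interval is short. *)
Lemma itv_L1_le_L2 f a b (e : R) : a <= b <= a + 1 -> measurable_fun setT f ->
  (Lp_norm 2%:E f <= e%:E)%E ->
  mu.-integrable `[a, b] (EFin \o f) /\ \int[mu]_(x in `[a, b]) `|f x| <= e.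
Proof.
move=> /andP[ab ba1] mf fe.
have mI : measurable_fun setT (\1_(`[a, b]) : R -> R) by exact: measurable_indic.
have half : (2^-1 + 2^-1 = 1 :> R) by lra.
have := @hoelder _ _ R mu f (\1_(`[a, b])) 2 2 mf mI (ltr0Sn _ _) (ltr0Sn _ _) half.
rewrite Lnorm1.
have -> : (\int[mu]_x `|(EFin \o (f \* \1_(`[a, b]))%R) x| = \int[mu]_(x in `[a, b]) `|f x|%:E)%E.
  rewrite [RHS]integral_mkcond; apply: eq_integral => x _.
  rewrite patchE /= indicE; case: ifPn => xab; first by rewrite mulr1.
  by rewrite mulr0 normr0.
have N1 : ('N[mu]_2%:E[EFin \o (\1_(`[a, b]) : R -> R)] <= 1)%E.
  rewrite unlock.
  have -> : (\int[mu]_x (`|(EFin \o (\1_(`[a, b]) : R -> R)) x| `^ 2) = (b - a)%:E)%E.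
    rewrite -lebesgue_measure_itvcc// -[X in _ = mu X]setIT -integral_indic//.
    apply: eq_integral => x _ /=; rewrite indicE; case: (_ \in _) => /=.
      by rewrite normr1 powR1.
    by rewrite normr0 powR0.
  rewrite poweR_EFin lee_fin; apply: (@le_trans _ _ (1 `^ 2^-1)); last by rewrite powR1.
  by apply: ge0_ler_powR; rewrite ?nnegrE ?subr_ge0//; lra.
move=> h; have e0 : (0 <= e%:E)%E by apply: le_trans fe; exact: Lp_norm_ge0.
have {}h : (\int[mu]_(x in `[a, b]) `|f x|%:E <= e%:E)%E.
  apply: (le_trans h); rewrite -[leRHS]mule1.
  by apply: lee_pmul => //; exact: Lnorm_ge0.
have fi : mu.-integrable `[a, b] (EFin \o f).
  apply/integrableP; split; first by apply/measurable_EFinP; exact: measurable_funTS.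
  by apply: le_lt_trans h _; rewrite ltry.
split=> //; rewrite -lee_fin /Rintegral fineK//.
exact/integrable_fin_num/integrable_norm.
Qed.

End BoundedWeakDerivative.

(** * The Helmholtz potential of a bounded function *)

Section HelmholtzPotential.
Context {R : realType}.
Local Notation mu := (@lebesgue_measure R).
Implicit Types (f g q : R -> R) (a b c h x y : R).

Lemma expR_taylor1 h : `|h| <= 2^-1 -> `|expR h - 1 - h| <= 2 * h ^+ 2.
Proof.
move=> /ler_normlP[h1 h2].
have lo := expR_ge1Dx h; have hi := expR_ge1Dx (- h).
have e0 := expR_gt0 h.
have : expR h * (1 - h) <= 1.
  rewrite -[leRHS](@expR0 R) -(addrN h) expRD ler_pM2l//; exact: expR_ge1Dx.
rewrite ler_norml => {}hi; apply/andP; split; first by have := sqr_ge0 h; lra.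
have h1' : 0 < 1 - h by lra.
rewrite -(ler_pM2r h1').
have -> : (expR h - 1 - h) * (1 - h) = expR h * (1 - h) - 1 + h ^+ 2 by ring.
have : 0 <= h ^+ 2 * (1 - 2 * h) by rewrite mulr_ge0 ?sqr_ge0//; lra.
by move: hi; lra.
Qed.

Lemma expRN_lipschitz a b : 0 <= a -> 0 <= b -> `|expR (- a) - expR (- b)| <= `|a - b|.
Proof.
have H c d : 0 <= c -> c <= d -> `|expR (- c) - expR (- d)| <= `|c - d|.
  move=> c0 cd.
  have -> : expR (- d) = expR (- c) * expR (- (d - c)) by rewrite -expRD; congr expR; ring.
  have e1 : expR (- c) <= 1 by rewrite -[leRHS](@expR0 R) ler_expR; lra.
  have e2 := expR_ge1Dx (- (d - c)).
  have e3 : expR (- (d - c)) <= 1 by rewrite -[leRHS](@expR0 R) ler_expR; lra.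
  have e0 := expR_gt0 (- c).
  rewrite ger0_norm; last first.
    by rewrite subr_ge0 ler_piMr// ltW.
  rewrite distrC ger0_norm ?subr_ge0//.
  by rewrite -[X in X - _]mulr1 -mulrBr; nra.
move=> a0 b0; have [ab|ba] := leP a b; first exact: H.
by rewrite distrC (distrC a); apply: H => //; exact: ltW.
Qed.

Definition exp_kernel x y := expR (- `|x - y|).
Definition kernel_sign x y : R := if x < y then 1 else -1.

(** First-order expansion in x of the kernel exp(-|x - y|).  If y is not between x
and x', the kernel is a pure exponential on the segment and Taylor applies;
otherwise the kink of the kernel costs a first-order error, but only for y in a
set of measure |x' - x|, so that both errors have integral O(|x' - x|^2). *)
Lemma exp_kernel_expansion x x' y : `|x' - x| <= 2^-1 ->
  `|exp_kernel x' y - exp_kernel x y - (x' - x) * (kernel_sign x y * exp_kernel x y)| <=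
  2 * (x' - x) ^+ 2 * exp_kernel x y +
  2 * `|x' - x| * \1_(`[Num.min x x', Num.max x x']) y.
Proof.
move=> h2; have k0 : 0 <= exp_kernel x y by exact: expR_ge0.
have k1 : exp_kernel x y <= 1 by rewrite /exp_kernel -[leRHS](@expR0 R) ler_expR oppr_le0.
rewrite indicE mem_setE in_itv/=; case: (boolP (_ <= _ <= _)) => [|/negP] bt.
  rewrite mulr1; apply: ler_wpDl; first by rewrite mulr_ge0// mulr_ge0// sqr_ge0.
  apply: le_trans (ler_normB _ _) _; rewrite [2 * _]mulr_natl mulr2n; apply: lerD.
    apply: le_trans (expRN_lipschitz (normr_ge0 _) (normr_ge0 _)) _.
    apply: le_trans (ler_dist_dist _ _) _.
    by rewrite opprB addrA subrK.
  rewrite normrM ler_piMr// normrM [X in _ * X]ger0_norm//.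
  rewrite /kernel_sign; case: ifP; rewrite ?normr1 ?normrN1 mul1r//.
rewrite mulr0 addr0.
have E (s : R) : `|s| = 1 -> s * (x' - y) = - `|x' - y| -> s * (x - y) = - `|x - y| ->
    kernel_sign x y = s ->
    `|exp_kernel x' y - exp_kernel x y - (x' - x) * (kernel_sign x y * exp_kernel x y)| <= 2 * (x' - x) ^+ 2 * exp_kernel x y.
  move=> s1 E1 E2 ->.
  have -> : exp_kernel x' y = exp_kernel x y * expR (s * (x' - x)).
    by rewrite /exp_kernel -expRD -E1 -E2; congr expR; ring.
  have -> : exp_kernel x y * expR (s * (x' - x)) - exp_kernel x y - (x' - x) * (s * exp_kernel x y) =
    exp_kernel x y * (expR (s * (x' - x)) - 1 - s * (x' - x)) by ring.
  rewrite normrM ger0_norm// mulrC ler_wpM2r//.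
  have hs : `|s * (x' - x)| <= 2^-1 by rewrite normrM s1 mul1r.
  apply: le_trans (expR_taylor1 hs) _.
  by rewrite exprMn -[s ^+ 2]ger0_norm ?sqr_ge0// normrX s1 expr1n mul1r.
have [xy|yx] := ltP x y.
- apply: (E 1); rewrite ?normr1 /kernel_sign ?xy// !mul1r.
    rewrite ltr0_norm ?opprK// subr_lt0 ltNge; apply/negP => yx'; apply: bt.
    by rewrite ge_min (ltW xy) le_max yx' orbT.
  by rewrite ltr0_norm ?opprK// subr_lt0.
- have nxy : (x < y) = false by rewrite ltNge yx.
  apply: (E (-1)); rewrite ?normrN1 /kernel_sign ?nxy// !mulN1r; congr (- _).
    rewrite gtr0_norm// subr_gt0 ltNge; apply/negP => yx'; apply: bt.
    by rewrite ge_min yx' orbT le_max yx.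
  by rewrite ger0_norm// subr_ge0.
Qed.

Lemma continuous_exp_kernel x : continuous (exp_kernel x).
Proof.
move=> y; apply: (@continuous_comp _ _ _ (fun y => - `|x - y|) expR); last exact: continuous_expR.
apply: cvgN; apply: cvg_norm; apply: cvgB; [exact: cvg_cst|exact: cvg_id].
Qed.

Lemma integral_exp_kernel_right x : (\int[mu]_(y in `[x, +oo[) (exp_kernel x y)%:E = 1)%E.
Proof.
pose F y := - (expR x * expR (- y)).
have dF y : is_derive y 1 F (expR (x - y)).
  have h : is_derive y 1 (fun y : R => expR (- y)) (- expR (- y)).
    have := is_derive_expRM (-1) y.
    have -> : (fun s : R => expR (-1 * s)) = (fun y => expR (- y)).
      by apply/funext => s; rewrite mulN1r.
    by rewrite !mulN1r.
  have hc := is_derive_cst (expR x) y (1 : R).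
  apply: (is_derive_eq (is_deriveN (is_deriveM hc h))).
  by rewrite expRD /GRing.scale/=; ring.
rewrite (@ge0_continuous_FTC2y _ (exp_kernel x) F x 0).
- by rewrite /F -expRD subrr expR0 EFinN oppeK add0e.
- by move=> y _; exact: expR_ge0.
- exact/continuous_subspaceT/continuous_exp_kernel.
- rewrite -oppr0 -[X in - X](mulr0 (expR x)); apply: cvgN; apply: cvgMr.
  exact: cvgr_expR.
- by move=> y _; have [] := dF y.
- apply: cvg_at_right_filter; have [+ _] := dF x.
  by move=> /derivable1_diffP/differentiable_continuous.
- move=> y; rewrite in_itv/= andbT => xy.
  by rewrite (derive1_is_derive dF) /exp_kernel ltr0_norm ?subr_lt0// opprK.
Qed.

Lemma integral_exp_kernel x : (\int[mu]_y (exp_kernel x y)%:E = 2%:E)%E.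
Proof.
have mk : measurable_fun setT (EFin \o exp_kernel x).
  by apply/measurable_EFinP; apply: continuous_measurable_fun; exact: continuous_exp_kernel.
rewrite -(setUv `[x, +oo[%classic) ge0_integral_setU//=; last 4 first.
- exact: measurableC.
- by rewrite setUv.
- by move=> y _; rewrite lee_fin expR_ge0.
- exact/disj_setPCl.
rewrite integral_exp_kernel_right setCitvr.
have -> : (\int[mu]_(y in `]-oo, x[) (exp_kernel x y)%:E = \int[mu]_(y in `]-oo, (- - x)%R]) (exp_kernel x y)%:E)%E.
  by rewrite opprK integral_itv_bndo_bndc//; exact: measurable_funTS.
rewrite ge0_integration_by_substitutionNy; last 2 first.
- exact/continuous_subspaceT/continuous_exp_kernel.
- by move=> y _; exact: expR_ge0.
rewrite -[in RHS](_ : (1 + 1 = 2%:E :> \bar R)%E)//; congr (_ + _)%E.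
rewrite -(integral_exp_kernel_right (- x)); apply: eq_integral => y _ /=.
by rewrite /exp_kernel -normrN; congr (expR (- `|_|))%:E; ring.
Qed.

Lemma integrable_exp_kernel x : mu.-integrable setT (EFin \o exp_kernel x).
Proof.
apply/integrableP; split.
  by apply/measurable_EFinP; apply: continuous_measurable_fun; exact: continuous_exp_kernel.
under eq_integral do rewrite /= ger0_norm ?expR_ge0//.
by rewrite integral_exp_kernel ltry.
Qed.

Let integrable_mul_ker q (f : R -> R) (Q : R) : measurable_fun setT q ->
  (forall x, `|q x| <= Q) -> measurable_fun setT f ->
  mu.-integrable setT (EFin \o f) ->
  mu.-integrable setT (EFin \o (fun y => f y * q y)).
Proof.
move=> mq qQ mf fi.
apply: (@le_integrable _ _ R mu setT measurableT _ (fun y => Q%:E * (EFin \o f) y)%E) => //.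
- by apply/measurable_EFinP; exact: measurable_funM.
- move=> y _ /=; rewrite lee_fin normrM [leRHS]normrM mulrC ler_wpM2r//.
  by rewrite (le_trans (qQ y))// ler_norm.
- exact: integrableZl.
Qed.

Definition exp_potential q x := \int[mu]_y (exp_kernel x y * q y).
Definition exp_potential_slope q x := \int[mu]_y (kernel_sign x y * exp_kernel x y * q y).

Lemma exp_potential_expansion q (Q x x' : R) : measurable_fun setT q ->
  (forall x, `|q x| <= Q) -> `|x' - x| <= 2^-1 ->
  `|exp_potential q x' - exp_potential q x - (x' - x) * exp_potential_slope q x| <= 6 * Q * (x' - x) ^+ 2.
Proof.
move=> mq qQ h2.
have Q0 : 0 <= Q by exact: le_trans (qQ 0).
have mk z : measurable_fun setT (exp_kernel z).
  by apply: continuous_measurable_fun; exact: continuous_exp_kernel.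
have mI : measurable `[Num.min x x', Num.max x x']%classic by [].
have ms : measurable_fun setT (kernel_sign x).
  by apply: measurable_fun_ifT => //; apply: measurable_fun_ltr.
have msk : measurable_fun setT (fun y => kernel_sign x y * exp_kernel x y).
  by apply: measurable_funM; [exact: ms|exact: mk].
have sk : mu.-integrable setT (EFin \o (fun y => kernel_sign x y * exp_kernel x y)).
  apply: (@le_integrable _ _ R mu setT measurableT _ (EFin \o exp_kernel x)) => //.
  - exact/measurable_EFinP.
  - move=> y _ /=; rewrite lee_fin normrM /kernel_sign.
    by case: ifP; rewrite ?normr1 ?normrN1 mul1r.
  - exact: integrable_exp_kernel.
have i1 := integrable_mul_ker mq qQ (mk x') (integrable_exp_kernel x').
have i2 := integrable_mul_ker mq qQ (mk x) (integrable_exp_kernel x).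
have i3 := integrable_mul_ker mq qQ msk sk.
have i4 : mu.-integrable setT (EFin \o (fun y => (x' - x) * (kernel_sign x y * exp_kernel x y * q y))).
  exact: (integrableZl measurableT (x' - x) i3).
rewrite /exp_potential_slope -RintegralZl// -RintegralB// -RintegralB//; last first.
  exact: (integrableB measurableT i1 i2).
set d := `|x' - x|.
pose B y := Q * (2 * (x' - x) ^+ 2) * exp_kernel x y +
   Q * (2 * d) * \1_(`[Num.min x x', Num.max x x']) y.
have iI : mu.-integrable setT (EFin \o (\1_(`[Num.min x x', Num.max x x']) : R -> R)).
  exact: integrable_indic_itv.
have iB1 : mu.-integrable setT (EFin \o (fun y => Q * (2 * (x' - x) ^+ 2) * exp_kernel x y)).
  exact: (integrableZl measurableT _ (integrable_exp_kernel x)).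
have iB2 : mu.-integrable setT
   (EFin \o (fun y => Q * (2 * d) * \1_(`[Num.min x x', Num.max x x']) y)).
  exact: (integrableZl measurableT _ iI).
have iB : mu.-integrable setT (EFin \o B) by exact: (integrableD measurableT iB1 iB2).
have itot : mu.-integrable setT (EFin \o (fun y => exp_kernel x' y * q y - exp_kernel x y * q y
     - (x' - x) * (kernel_sign x y * exp_kernel x y * q y))).
  exact: (integrableB measurableT (integrableB measurableT i1 i2) i4).
rewrite (le_trans (le_normr_Rintegral _ _))//.
apply: (@le_trans _ _ (\int[mu]_y B y)).
  apply: le_Rintegral => //; first exact: integrable_norm.
  move=> y _.
  have -> : exp_kernel x' y * q y - exp_kernel x y * q y - (x' - x) * (kernel_sign x y * exp_kernel x y * q y) =
    q y * (exp_kernel x' y - exp_kernel x y - (x' - x) * (kernel_sign x y * exp_kernel x y)) by ring.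
  rewrite normrM /B -!mulrA -mulrDr ler_pM//.
  by have := exp_kernel_expansion y h2; rewrite -!mulrA.
rewrite RintegralD// RintegralZl//; last exact: integrable_exp_kernel.
rewrite RintegralZl//.
have -> : \int[mu]_y exp_kernel x y = 2 by rewrite /Rintegral integral_exp_kernel.
have -> : \int[mu]_y \1_(`[Num.min x x', Num.max x x']) y = d.
  have E : (\int[mu]_y (\1_(`[Num.min x x', Num.max x x']) y)%:E =
      (Num.max x x' - Num.min x x')%:E)%E.
    rewrite -lebesgue_measure_itvcc; last by rewrite ge_min le_max lexx.
    by rewrite integral_indic//; congr (mu _); exact: setIT.
  rewrite /Rintegral E /= /d; case: (leP x x') => xx'.
    by rewrite ger0_norm// subr_ge0.
  by rewrite ltr0_norm ?subr_lt0// opprB.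
have -> : (x' - x) ^+ 2 = d * d by rewrite /d -expr2 real_normK ?num_real.
lra.
Qed.

Definition inv_helmholtz_slope q x := 2^-1 * exp_potential_slope q x.

Let mul_ker_bound q (f : R -> R) (Q : R) x : measurable_fun setT q ->
  (forall x, `|q x| <= Q) -> measurable_fun setT f -> (forall y, `|f y| <= 1) ->
  `|\int[mu]_y (f y * exp_kernel x y * q y)| <= 2 * Q.
Proof.
move=> mq qQ mf f1.
have mk : measurable_fun setT (exp_kernel x).
  by apply: continuous_measurable_fun; exact: continuous_exp_kernel.
have mfk : measurable_fun setT (fun y => f y * exp_kernel x y) by exact: measurable_funM.
have fki : mu.-integrable setT (EFin \o (fun y => f y * exp_kernel x y)).
  apply: (@le_integrable _ _ R mu setT measurableT _ (EFin \o exp_kernel x)).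
  - exact/measurable_EFinP.
  - by move=> y _ /=; rewrite lee_fin normrM ler_piMl.
  - exact: integrable_exp_kernel.
have ii := integrable_mul_ker mq qQ mfk fki.
rewrite (le_trans (le_normr_Rintegral _ _))//.
apply: (@le_trans _ _ (\int[mu]_y (Q * exp_kernel x y))).
  apply: le_Rintegral => //; first exact: integrable_norm.
    exact: (integrableZl measurableT _ (integrable_exp_kernel x)).
  move=> y _; rewrite normrM mulrC ler_pM// normrM.
  by rewrite [X in _ * X]ger0_norm ?expR_ge0// ler_piMl// expR_ge0.
rewrite RintegralZl//; last exact: integrable_exp_kernel.
by rewrite mulrC /Rintegral integral_exp_kernel.
Qed.

(** The convolution of a bounded function with exp(-|x|) / 2 is differentiable with
a quadratic remainder.  The bound on q holds almost everywhere, which is enough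
since q enters through integrals only. *)
Lemma inv_helmholtz_bounds q (Q : R) : 0 <= Q -> measurable_fun setT q ->
  {ae mu, forall x, `|q x| <= Q} ->
  [/\ forall x, `|inv_helmholtz q x| <= Q,
      forall x, `|inv_helmholtz_slope q x| <= Q &
      forall x x', `|x' - x| <= 2^-1 ->
      `|inv_helmholtz q x' - inv_helmholtz q x - (x' - x) * inv_helmholtz_slope q x|
        <= 3 * Q * (x' - x) ^+ 2].
Proof.
move=> Q0 mq qQ; have [p [mp pQ qp]] := ae_bounded_representative Q0 mq qQ.
have mk x : measurable_fun setT (exp_kernel x).
  by apply: continuous_measurable_fun; exact: continuous_exp_kernel.
have ms x : measurable_fun setT (kernel_sign x).
  by apply: measurable_fun_ifT => //; exact: measurable_fun_ltr.
have Jp x : inv_helmholtz q x = 2^-1 * exp_potential p x.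
  rewrite /inv_helmholtz /exp_potential; congr (_ * _).
  apply: Rintegral_ae_eq => //; try by apply: measurable_funM => //; exact: mk.
  move: qp; apply: filterS; first exact: (ae_filter_ringOfSetsType mu).
  by move=> y ->.
have Dp x : inv_helmholtz_slope q x = 2^-1 * exp_potential_slope p x.
  rewrite /inv_helmholtz_slope /exp_potential_slope; congr (_ * _).
  have msk : measurable_fun setT (fun y => kernel_sign x y * exp_kernel x y).
    by apply: measurable_funM; [exact: ms|exact: mk].
  apply: Rintegral_ae_eq => //; try exact: measurable_funM.
  move: qp; apply: filterS; first exact: (ae_filter_ringOfSetsType mu).
  by move=> y ->.
have sgn1 x y : `|kernel_sign x y| <= 1 by rewrite /kernel_sign; case: ifP; rewrite ?normr1 ?normrN1.
split.
- move=> x; rewrite Jp normrM gtr0_norm// mulrC ler_pdivrMr// mulrC.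
  have := @mul_ker_bound p (fun=> 1) Q x mp pQ (measurable_cst _).
  by under eq_Rintegral do rewrite mul1r; apply => y; rewrite normr1.
- move=> x; rewrite Dp normrM gtr0_norm// mulrC ler_pdivrMr// mulrC.
  by apply: mul_ker_bound.
- move=> x x' xx'; rewrite !Jp !Dp.
  have := exp_potential_expansion mp pQ xx'.
  have -> : 2^-1 * exp_potential p x' - 2^-1 * exp_potential p x - (x' - x) * (2^-1 * exp_potential_slope p x) =
    2^-1 * (exp_potential p x' - exp_potential p x - (x' - x) * exp_potential_slope p x) by ring.
  rewrite [`|2^-1 * _|]normrM [`|2^-1|]gtr0_norm//; lra.
Qed.

End HelmholtzPotential.

(** * Regularity in time *)

Section TimeRegularity.
Context {R : realType}.
Local Notation mu := (@lebesgue_measure R).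
Implicit Types (f g k : R -> R) (u : R -> R -> R) (T t s x y h e eta : R) (N : R -> \bar R).

Lemma near_small_ereal (F : set_system R) {FF : Filter F} N e : 0 < e ->
  N s @[s --> F] --> 0%E -> \forall s \near F, (N s <= e%:E)%E.
Proof.
move=> e0 N0.
have : nbhs (0%E : \bar R) [set y | (y < e%:E)%E].
  by apply: open_nbhs_nbhs; split; [exact: open_ereal_lt_ereal|rewrite /= lte_fin].
by move=> /N0 h; apply: (@filterS _ F FF _ _ _ h) => s /= /ltW.
Qed.

Lemma within_time_small T t N e : 0 < e ->
  N s @[s --> within (in_time T) (nbhs t)] --> 0%E ->
  exists2 r : R, 0 < r & forall s, in_time T s -> `|s - t| < r -> (N s <= e%:E)%E.
Proof.
move=> e0 /(near_small_ereal e0); rewrite near_withinE => /nbhs_ballP[r /= r0 rP].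
by exists r => // s sT sr; apply: rP => //; rewrite /ball/= distrC.
Qed.

Lemma within_dtime_small T t N e : 0 < e ->
  N s @[s --> within (in_time T) t^'] --> 0%E ->
  exists2 r : R, 0 < r & forall s, in_time T s -> s != t -> `|s - t| < r ->
    (N s <= e%:E)%E.
Proof.
move=> e0 /(near_small_ereal e0); rewrite near_withinE near_withinE.
move=> /nbhs_ballP[r /= r0 rP].
by exists r => // s sT st sr; apply: rP => //; rewrite /ball/= distrC.
Qed.

(** Pointwise closeness from L^2 closeness, for functions of small oscillation:
average over [x, x + h]. *)
Lemma close_of_L2 f k x h eta e : 0 < h <= 1 -> locally_integrable setT f ->
  locally_integrable setT k ->
  (forall y, x <= y <= x + h -> `|f y - f x| <= eta) ->
  (forall y, x <= y <= x + h -> `|k y - k x| <= eta) ->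
  (Lp_norm 2%:E (f \- k)%R <= e%:E)%E ->
  h * `|f x - k x| <= 2 * (h * eta) + e.
Proof.
move=> /andP[h0 h1] fi ki fx kx fk.
have xh : x <= x + h by rewrite lerDl ltW.
have xh1 : x <= x + h <= x + 1 by rewrite xh lerD2l.
have mfk : measurable_fun setT (f \- k).
  by case: fi => mf _ _; case: ki => mk _ _; exact: measurable_funB.
have [ifk fke] := itv_L1_le_L2 xh1 mfk fk.
have E : \int[mu]_(y in `[x, x + h]) (`|f x - k x|) = h * `|f x - k x|.
  by rewrite Rintegral_cst//= lebesgue_measure_itvcc//= [x + h - x]addrAC subrr add0r mulrC.
have E2 : \int[mu]_(y in `[x, x + h]) (2 * eta) = 2 * (h * eta).
  by rewrite Rintegral_cst//= lebesgue_measure_itvcc//= [x + h - x]addrAC subrr add0r -mulrA [eta * h]mulrC.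
have ic (c : R) : mu.-integrable `[x, x + h] (EFin \o (fun=> c)).
  by apply: locally_integrable_itv; apply: continuous_locally_integrable => z; exact: cvg_cst.
rewrite -E -E2; apply: (@le_trans _ _ (\int[mu]_(y in `[x, x + h]) (2 * eta + `|f y - k y|))).
  apply: le_Rintegral => //.
    exact: (integrableD _ (ic _) (integrable_norm ifk)).
  move=> y; rewrite /= in_itv/= => xy.
  have -> : f x - k x = (f y - k y) - (f y - f x) + (k y - k x) by ring.
  rewrite (le_trans (ler_normD _ _))//.
  have := ler_normB (f y - k y) (f y - f x).
  have := fx y xy; have := kx y xy; lra.
rewrite RintegralD//; last exact: integrable_norm.
by rewrite lerD2l.
Qed.

Lemma lipschitz_continuous f (M : R) : (forall x y, `|f x - f y| <= M * `|x - y|) ->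
  continuous f.
Proof.
move=> fM x; apply/cvgrPdist_le => e e0; apply/nbhs_ballP.
have M1 : 0 < `|M| + 1 by rewrite ltr_wpDl.
exists (e / (`|M| + 1)) => /=; first by rewrite divr_gt0.
move=> y; rewrite /ball/= ltr_pdivlMr// => xy; rewrite (le_trans (fM _ _))//.
rewrite (le_trans _ (ltW xy))// mulrC ler_wpM2l//.
by rewrite (le_trans (ler_norm M))// lerDl.
Qed.

(** The times at which u s obeys the bounds have full measure, so they are dense;
u t is an L^2 limit of such u s, and equi-Lipschitz functions that converge in
L^2 converge pointwise, where they are averaged over small windows. *)
Lemma uniform_lipschitz T u : 0 < T ->
  (forall t, in_time T t -> continuous (u t)) -> C_L2 T u -> Linfty_W1infty T u ->
  exists2 M : R, 0 <= M & forall t, in_time T t ->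
    (forall x, `|u t x| <= M) /\ (forall x y, `|u t x - u t y| <= M * `|x - y|).
Proof.
move=> T0 cu uL2 [M0 uM]; pose M := `|M0|; have Mge0 : 0 <= M by exact: normr_ge0.
exists M => // t tT.
have good e : 0 < e -> exists s, [/\ in_time T s,
    (Lp_norm 2%:E (u s \- u t)%R <= e%:E)%E, forall x, `|u s x| <= M &
    forall x y, `|u s x - u s y| <= M * `|x - y|].
  move=> e0; have [_ /(within_time_small e0)[r r0 rP]] := uL2 t tT.
  have lohi : Num.max 0 (t - r) < Num.min T (t + r).
    move: tT => /andP[t0 tT]; rewrite lt_min !gt_max T0/=; apply/andP; split; first by lra.
    by apply/andP; split; lra.
  have [s /andP[s1 s2] sP] := ae_itv_witness lohi uM.
  move: s1 s2; rewrite gt_max lt_min => /andP[s0 s1] /andP[s2 s3].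
  have sT : in_time T s by rewrite /in_time/= !ltW.
  have [sW sN] := sP sT.
  have sN' : (W1_norm +oo%E (u s) <= M%:E)%E.
    by rewrite (le_trans sN)// lee_fin ler_norm.
  have [h1 h2] := W1infty_lipschitz (cu s sT) sW sN'.
  exists s; split => //; apply: rP => //.
  by rewrite ltr_norml; apply/andP; split; lra.
have close x eta : 0 < eta -> exists2 r : R, 0 < r & forall s, (forall x y, `|u s x - u s y| <= M * `|x - y|) ->
   locally_integrable setT (u s) ->
   (Lp_norm 2%:E (u s \- u t)%R <= r%:E)%E -> `|u s x - u t x| <= 3 * eta.
  move=> eta0; have /cvgrPdist_le/(_ _ eta0)/nbhs_ballP[d /= d0 dP] := cu t tT x.
  pose h := Num.min 1 (Num.min (d / 2) (eta / (M + 1))).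
  have M1 : 0 < M + 1 by rewrite ltr_wpDl.
  have h0 : 0 < h by rewrite !lt_min ltr01 !divr_gt0.
  have h1 : h <= 1 by rewrite ge_min lexx.
  have hd : h < d.
    have : h <= d / 2 by rewrite /h !ge_min lexx orbT.
    by lra.
  have hM : M * h <= eta.
    have : h <= eta / (M + 1) by rewrite /h !ge_min lexx !orbT.
    by rewrite ler_pdivlMr// mulrDr mulr1 mulrC; have := ltW h0; lra.
  exists (h * eta) => [|s sL si sN]; first by rewrite mulr_gt0.
  have := @close_of_L2 (u s) (u t) x h eta (h * eta).
  rewrite h0 h1 => /(_ isT si (continuous_locally_integrable (cu t tT))) H.
  have : h * `|u s x - u t x| <= 2 * (h * eta) + h * eta.
    apply: H => // y /andP[xy yh].
      rewrite (le_trans (sL _ _))// (le_trans _ hM)// ler_wpM2l//.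
      by rewrite ger0_norm ?subr_ge0// lerBlDl.
    rewrite distrC; apply: dP; rewrite /ball/= distrC ger0_norm ?subr_ge0//.
    by rewrite ltrBlDl (le_lt_trans yh)// ltrD2l.
  have -> : 2 * (h * eta) + h * eta = h * (3 * eta) by ring.
  by rewrite ler_pM2l.
split.
- move=> x; apply/ler_addgt0Pr => e e0.
  have e3 : 0 < e / 3 by rewrite divr_gt0.
  have [r r0 rP] := close x _ e3.
  have [s [sT sN s1 s2]] := good r r0.
  have := rP s s2 (continuous_locally_integrable (cu s sT)) sN.
  have := s1 x; have := ler_normB (u s x) (u s x - u t x); rewrite subKr; lra.
- move=> x y; apply/ler_addgt0Pr => e e0.
  have e6 : 0 < e / 6 by rewrite divr_gt0.
  have [rx rx0 rxP] := close x _ e6; have [ry ry0 ryP] := close y _ e6.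
  have r0 : 0 < Num.min rx ry by rewrite lt_min rx0.
  have [s [sT sN s1 s2]] := good _ r0.
  have si := continuous_locally_integrable (cu s sT).
  have hx : `|u s x - u t x| <= 3 * (e / 6).
    by apply: rxP => //; rewrite (le_trans sN)// lee_fin ge_min lexx.
  have hy : `|u s y - u t y| <= 3 * (e / 6).
    by apply: ryP => //; rewrite (le_trans sN)// lee_fin ge_min lexx orbT.
  have -> : u t x - u t y = (u s x - u s y) - (u s x - u t x) + (u s y - u t y) by ring.
  rewrite (le_trans (ler_normD _ _))//.
  have := ler_normB (u s x - u s y) (u s x - u t x); have := s2 x y; lra.
Qed.

(** For equi-Lipschitz functions, continuity in L^2 upgrades to uniform
convergence. *)
Lemma uniform_time_continuity T u (M t e : R) : 0 <= M ->
  (forall s, in_time T s -> forall x y, `|u s x - u s y| <= M * `|x - y|) ->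
  C_L2 T u -> in_time T t -> 0 < e ->
  exists2 r : R, 0 < r & forall s, in_time T s -> `|s - t| < r ->
    forall x, `|u s x - u t x| <= e.
Proof.
move=> M0 uM uL2 tT e0.
have M1 : 0 < M + 1 by rewrite ltr_wpDl.
pose h := Num.min 1 (e / 3 / (M + 1)).
have e3 : 0 < e / 3 by rewrite divr_gt0.
have h0 : 0 < h by rewrite lt_min ltr01 divr_gt0.
have h1 : h <= 1 by rewrite ge_min lexx.
have hM : M * h <= e / 3.
  have : h <= e / 3 / (M + 1) by rewrite /h !ge_min lexx !orbT.
  by rewrite ler_pdivlMr// mulrDr mulr1 mulrC; have := ltW h0; lra.
have he : 0 < h * (e / 3) by rewrite mulr_gt0.
have [_ /(within_time_small he)[r r0 rP]] := uL2 t tT.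
exists r => // s sT sr x.
have osc z : in_time T z -> forall y, x <= y <= x + h -> `|u z y - u z x| <= e / 3.
  move=> zT y /andP[xy yh]; rewrite (le_trans (uM _ zT _ _))// (le_trans _ hM)// ler_wpM2l//.
  by rewrite ger0_norm ?subr_ge0// lerBlDl.
have ci z : in_time T z -> locally_integrable setT (u z).
  by move=> zT; apply: continuous_locally_integrable; exact: lipschitz_continuous (uM z zT).
have hh : 0 < h <= 1 by rewrite h0 h1.
have := close_of_L2 hh (ci _ sT) (ci _ tT) (osc _ sT) (osc _ tT) (rP s sT sr).
have -> : 2 * (h * (e / 3)) + h * (e / 3) = h * e by field.
by rewrite ler_pM2l.
Qed.

End TimeRegularity.

(** * The equation along characteristics *)

Section Windows.
Context {R : realType}.
Local Notation mu := (@lebesgue_measure R).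
Implicit Types (f g : R -> R) (x y h a b c : R).

Definition window g h x := \int[mu]_(y in `[x, x + h]) g y.

Lemma window_shift g h x y : 0 <= h -> x <= y -> locally_integrable setT g ->
  window g h y - window g h x =
  \int[mu]_(z in `[x + h, y + h]) g z - \int[mu]_(z in `[x, y]) g z.
Proof.
move=> h0 xy gi.
have i a b := locally_integrable_itv a b gi.
have xyh : x <= y + h by lra.
have e1 := @Rintegral_split _ g x (y + h) y xy (ltac:(lra)) (i _ _).
have e2 := @Rintegral_split _ g x (y + h) (x + h) (ltac:(lra)) (ltac:(lra)) (i _ _).
by rewrite /window; move: e1 e2; lra.
Qed.

Lemma window_lipschitz g h x y (B : R) : 0 <= h -> measurable_fun setT g ->
  (forall z, `|g z| <= B) -> `|window g h x - window g h y| <= 2 * B * `|x - y|.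
Proof.
move=> h0 mg gB; have gi := bounded_locally_integrable mg gB.
have H a b : a <= b -> `|window g h b - window g h a| <= 2 * B * `|b - a|.
  move=> ab; rewrite window_shift// (le_trans (ler_normB _ _))//.
  have abh : a + h <= b + h by rewrite lerD2r.
  have := Rintegral_le_bound abh (locally_integrable_itv _ _ gi) (fun z _ => gB z).
  have := Rintegral_le_bound ab (locally_integrable_itv _ _ gi) (fun z _ => gB z).
  rewrite [`|b - a|]ger0_norm ?subr_ge0//; lra.
have [xy|yx] := leP x y; last by apply: H; exact: ltW.
by rewrite distrC [`|x - y|]distrC; exact: H.
Qed.

(** The derivative is the flux through the two endpoints; f being Lipschitz, it is
constant up to O(|s - x|) on the pieces gained and lost by the window. *)
Lemma is_derive_window f h x (M : R) : 0 <= h ->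
  (forall y z, `|f y - f z| <= M * `|y - z|) ->
  is_derive x 1 (window f h) (f (x + h) - f x).
Proof.
move=> h0 fM; have cf := lipschitz_continuous fM.
have fi := continuous_locally_integrable cf.
have M0 : 0 <= M by have := fM 1 0; rewrite subr0 normr1 mulr1; exact: le_trans.
have near_cst a b c : a <= c <= b ->
    `|\int[mu]_(z in `[a, b]) f z - (b - a) * f c| <= M * (b - a) * (b - a).
  move=> /andP[ac cb]; have ab := le_trans ac cb.
  have ic : locally_integrable setT (fun=> f c : R).
    by apply: continuous_locally_integrable => z; exact: cvg_cst.
  have -> : (b - a) * f c = \int[mu]_(z in `[a, b]) f c.
    by rewrite Rintegral_cst//= lebesgue_measure_itvcc//= mulrC.
  rewrite -RintegralB//; try exact: locally_integrable_itv.
  apply: Rintegral_le_bound => //.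
    exact: (locally_integrable_itv a b (locally_integrableB fi ic)).
  move=> z /andP[az zb]; rewrite (le_trans (fM _ _))// ler_wpM2l//.
  by rewrite ler_norml; apply/andP; split; lra.
apply/is_derive_epsP => e e0.
have M1 : 0 < 2 * M + 1 by rewrite ltr_wpDl// mulr_ge0.
exists (e / (2 * M + 1)); first by rewrite divr_gt0.
move=> s; rewrite ltr_pdivlMr// => se.
apply: (@le_trans _ _ (2 * M * `|s - x| * `|s - x|)); last first.
  rewrite ler_wpM2r//; have := normr_ge0 (s - x); lra.
have [xs|sx] := leP x s.
  have -> : window f h s - window f h x - (s - x) * (f (x + h) - f x) =
    (\int[mu]_(z in `[x + h, s + h]) f z - (s + h - (x + h)) * f (x + h)) -
    (\int[mu]_(z in `[x, s]) f z - (s - x) * f x).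
    by rewrite window_shift//; ring.
  rewrite (le_trans (ler_normB _ _))//.
  have := near_cst x s x; rewrite lexx xs => /(_ isT).
  have := near_cst (x + h) (s + h) (x + h); rewrite lexx lerD2r xs => /(_ isT).
  rewrite [`|s - x|]ger0_norm ?subr_ge0//.
  have -> : s + h - (x + h) = s - x by ring.
  lra.
have sx' := ltW sx.
have -> : window f h s - window f h x - (s - x) * (f (x + h) - f x) =
    (\int[mu]_(z in `[s, x]) f z - (x - s) * f x) -
    (\int[mu]_(z in `[s + h, x + h]) f z - (x + h - (s + h)) * f (x + h)).
  by have := window_shift h0 sx' fi => E; rewrite -[window f h s - _]opprB E; ring.
rewrite (le_trans (ler_normB _ _))//.
have := near_cst s x x; rewrite lexx sx' => /(_ isT).
have := near_cst (s + h) (x + h) (x + h); rewrite lexx lerD2r sx' => /(_ isT).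
rewrite [`|s - x|]ler0_norm ?subr_le0// opprB.
have -> : x + h - (s + h) = x - s by ring.
lra.
Qed.

End Windows.

Section CharacteristicEquation.
Context {R : realType}.
Local Notation mu := (@lebesgue_measure R).
Context (T M : R) (u ut : R -> R -> R).
Context (M0 : 0 <= M).
Context (uM : forall t : R, in_time T t -> forall x, `|u t x| <= M).
Context (uL : forall t : R, in_time T t -> forall x y, `|u t x - u t y| <= M * `|x - y|).
Context (uL2 : C_L2 T u) (utL2 : C_L2 T ut) (dut : is_time_deriv_L2 T u ut).
Context (uW : forall t : R, in_time T t -> exists g, is_weak_deriv (u t) g).

(** The nonlocal term 3/2 (1 - d_x^2)^{-1} d_x (u^2) of the equation: minus the
acceleration of the particles. *)
Definition DP_force (t x : R) : R :=
  3 / 2 * inv_helmholtz (weak_deriv (fun y => u t y ^+ 2)) x.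

Definition DP_force_slope (t x : R) : R :=
  3 / 2 * inv_helmholtz_slope (weak_deriv (fun y => u t y ^+ 2)) x.

Context (ut_eq : forall t : R, in_time T t -> {ae mu, forall x,
  ut t x + u t x * weak_deriv (u t) x + DP_force t x = 0}).

Let cu (t : R) : in_time T t -> continuous (u t).
Proof. by move=> tT; exact: lipschitz_continuous (uL tT). Qed.

Let M2_ge0 : 0 <= M ^+ 2. Proof. exact: sqr_ge0. Qed.

(** u^2 is Lipschitz with constant 2 M^2, which bounds its weak derivative. *)
Lemma DP_force_bounds (t : R) : in_time T t ->
  [/\ forall x, `|DP_force t x| <= 3 * M ^+ 2,
      forall x, `|DP_force_slope t x| <= 3 * M ^+ 2 &
      forall x x', `|x' - x| <= 2^-1 ->
      `|DP_force t x' - DP_force t x - (x' - x) * DP_force_slope t x|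
        <= 9 * M ^+ 2 * (x' - x) ^+ 2].
Proof.
move=> tT.
have sqL x y : `|u t x ^+ 2 - u t y ^+ 2| <= 2 * M ^+ 2 * `|x - y|.
  have -> : u t x ^+ 2 - u t y ^+ 2 = (u t x + u t y) * (u t x - u t y) by ring.
  rewrite normrM.
  have -> : 2 * M ^+ 2 * `|x - y| = 2 * M * (M * `|x - y|) by ring.
  apply: ler_pM => //; last exact: uL.
  by rewrite (le_trans (ler_normD _ _))//; have := uM tT x; have := uM tT y; lra.
have csq : continuous (fun y => u t y ^+ 2) by exact: lipschitz_continuous sqL.
have [[mq _ _] qQ] := weak_deriv_of_lipschitz csq sqL.
have Q0 : 0 <= 2 * M ^+ 2 by rewrite mulr_ge0.
have [h1 h2 h3] := inv_helmholtz_bounds Q0 mq qQ.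
have n32 : `|3 / 2 : R| = 3 / 2 by rewrite ger0_norm.
split=> [x|x|x x' xx'].
- by rewrite /DP_force normrM n32; have := h1 x; lra.
- by rewrite /DP_force_slope normrM n32; have := h2 x; lra.
- rewrite /DP_force /DP_force_slope.
  set q := weak_deriv _.
  have -> : 3 / 2 * inv_helmholtz q x' - 3 / 2 * inv_helmholtz q x -
     (x' - x) * (3 / 2 * inv_helmholtz_slope q x) =
    3 / 2 * (inv_helmholtz q x' - inv_helmholtz q x - (x' - x) * inv_helmholtz_slope q x).
    by ring.
  by rewrite normrM n32; have := h3 x x' xx'; rewrite -/q; lra.
Qed.

Lemma DP_force_locally_lipschitz (t x x' : R) : in_time T t -> `|x' - x| <= 2^-1 ->
  `|DP_force t x' - DP_force t x| <= 8 * M ^+ 2 * `|x' - x|.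
Proof.
move=> tT xx'; have [_ h2 h3] := DP_force_bounds tT.
have := h3 _ _ xx'; set d := x' - x => hd; rewrite -/d in xx'.
have -> : DP_force t x' - DP_force t x =
  (DP_force t x' - DP_force t x - d * DP_force_slope t x) + d * DP_force_slope t x by ring.
rewrite (le_trans (ler_normD _ _))// normrM.
have : `|d| * `|DP_force_slope t x| <= `|d| * (3 * M ^+ 2) by rewrite ler_wpM2l.
have : d ^+ 2 <= 2^-1 * `|d| by rewrite -(real_normK (num_real d)) expr2 ler_wpM2r.
move=> /(ler_wpM2l M2_ge0).
have := mulr_ge0 M2_ge0 (normr_ge0 d); move: hd; lra.
Qed.

Lemma continuous_DP_force (t : R) : in_time T t -> continuous (DP_force t).
Proof.
move=> tT x; apply/cvgrPdist_le => e e0; apply/nbhs_ballP.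
have C1 : 0 < 8 * M ^+ 2 + 1 by rewrite ltr_wpDl// mulr_ge0.
exists (Num.min 2^-1 (e / (8 * M ^+ 2 + 1))) => /=.
  by rewrite lt_min invr_gt0 ltr0n divr_gt0.
move=> y; rewrite /ball/= distrC lt_min => /andP[y2].
rewrite ltr_pdivlMr// => ye; rewrite distrC.
apply: le_trans (DP_force_locally_lipschitz tT (ltW y2)) _.
by have := normr_ge0 (y - x); lra.
Qed.

(* through the equation u_t inherits the bounds of - u u_x - F *)
Let ut_repr (t : R) : in_time T t -> exists p : R -> R,
  [/\ measurable_fun setT p, forall x, `|p x| <= M,
     forall a b, a < b -> u t b - u t a = \int[mu]_(x in `[a, b]) p x &
     {ae mu, forall x, ut t x = - (u t x * p x) - DP_force t x}].
Proof.
move=> tT; have [[mw iw iw'] wM] := weak_deriv_of_lipschitz (cu tT) (uL tT).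
have [p [mp pM wp]] := ae_bounded_representative M0 mw wM.
exists p; split => //.
- move=> a b ab; have [g fg] := uW tT.
  rewrite (weak_deriv_FTC (cu tT) (xgetPex (cst 0) (ex_intro _ g fg)) ab).
  apply: Rintegral_ae_eq => //; [exact: measurable_funTS|exact: measurable_funTS|].
  move: wp; apply: filterS; first exact: (ae_filter_ringOfSetsType mu).
  by move=> x + _.
- move: (ut_eq tT) wp; apply: filterS2; first exact: (ae_filter_ringOfSetsType mu).
  by move=> x + <-; lra.
Qed.

Let mut (t : R) : in_time T t -> measurable_fun setT (ut t).
Proof. by move=> /utL2[]; rewrite inE => /andP[]; rewrite inE. Qed.

Let m_bound (t x : R) (p : R -> R) : in_time T t -> `|p x| <= M ->
  `|- (u t x * p x) - DP_force t x| <= 4 * M ^+ 2.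
Proof.
move=> tT pM; have [h1 _ _] := DP_force_bounds tT.
rewrite (le_trans (ler_normB _ _))// normrN normrM.
have : `|u t x| * `|p x| <= M ^+ 2 by rewrite expr2 ler_pM// uM.
by have := h1 x; lra.
Qed.

Let m_measurable (t : R) (p : R -> R) : in_time T t -> measurable_fun setT p ->
  measurable_fun setT (fun x => - (u t x * p x) - DP_force t x).
Proof.
move=> tT mp.
have mu_ : measurable_fun setT (u t) by apply: continuous_measurable_fun; exact: cu.
have mF : measurable_fun setT (DP_force t).
  by apply: continuous_measurable_fun; exact: continuous_DP_force.
apply: measurable_funB => //; apply: measurableT_comp => //.
exact: measurable_funM.
Qed.

Let window_ut_lipschitz (t h x y : R) : in_time T t -> 0 <= h ->
  `|window (ut t) h x - window (ut t) h y| <= 8 * M ^+ 2 * `|x - y|.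
Proof.
move=> tT h0; have [p [mp pM _ up]] := ut_repr tT.
pose m x := - (u t x * p x) - DP_force t x.
have mm : measurable_fun setT m by exact: m_measurable.
have E z : window (ut t) h z = window m h z.
  apply: Rintegral_ae_eq => //.
  - by apply: measurable_funTS; exact: mut.
  - exact: measurable_funTS.
  - move: up; apply: filterS; first exact: (ae_filter_ringOfSetsType mu).
    by move=> w + _.
rewrite !E; have := @window_lipschitz _ m h x y (4 * M ^+ 2) h0 mm (fun z => m_bound tT (pM z)).
lra.
Qed.

Let L2_window (f : R -> R) (h x e : R) : 0 <= h <= 1 -> measurable_fun setT f ->
  (Lp_norm 2%:E f <= e%:E)%E -> `|window f h x| <= e.
Proof.
move=> /andP[h0 h1] mf fe.
have xh : x <= x + h <= x + 1 by rewrite lerDl h0 lerD2l.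
have [fi fle] := itv_L1_le_L2 xh mf fe.
exact: le_trans (le_normr_Rintegral _ fi) fle.
Qed.

Let Lfun2_window_integrable (f : R -> R) (h x : R) : 0 <= h <= 1 ->
  f \in Lfun mu 2%:E -> mu.-integrable `[x, x + h] (EFin \o f).
Proof.
move=> /andP[h0 h1]; rewrite inE => /andP[]; rewrite !inE /= => mf fi.
have f0 : (0 <= Lp_norm 2%:E f)%E by exact: Lp_norm_ge0.
have xh : x <= x + h <= x + 1 by rewrite lerDl h0 lerD2l.
apply: (proj1 (@itv_L1_le_L2 _ f x (x + h) (fine (Lp_norm 2%:E f)) xh mf _)).
by rewrite fineK// ge0_fin_numE.
Qed.

Let window_ut_sub (t s h x : R) : 0 <= h <= 1 -> in_time T s -> in_time T t ->
  window (ut s \- ut t) h x = window (ut s) h x - window (ut t) h x.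
Proof.
move=> h01 sT tT; rewrite /window RintegralB//; apply: Lfun2_window_integrable => //.
  by have [] := utL2 sT.
by have [] := utL2 tT.
Qed.

Context (X : R -> R).
Context (dX : forall t : R, 0 < t < T -> is_derive t 1 X (u t (X t))).

(* the mass of u in the window carried by the particle, and its derivative *)
Let A (h t : R) := window (u t) h (X t).
Let a (h t : R) := window (ut t) h (X t) + u t (X t) * (u t (X t + h) - u t (X t)).

Let inT (t : R) : 0 < t < T -> in_time T t.
Proof. by move=> /andP[t0 tT]; rewrite /in_time/= !ltW. Qed.

Let interval_nbhs (t : R) : 0 < t < T -> exists2 r : R, 0 < r &
  forall s : R, `|s - t| < r -> 0 < s < T.
Proof.
move=> /andP[t0 tT]; exists (Num.min t (T - t)).
  by rewrite lt_min t0 subr_gt0.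
move=> s; rewrite lt_min !ltr_norml => /andP[/andP[? ?] /andP[? ?]].
by apply/andP; split; lra.
Qed.

Let X_near (t : R) : 0 < t < T -> {for t, continuous X}.
Proof.
by move=> tT; have [+ _] := dX tT; move=> /derivable1_diffP/differentiable_continuous.
Qed.

Let u_near (t c : R) : 0 < t < T -> {for t, continuous (fun s => u s (X s + c))}.
Proof.
move=> tT; apply/cvgrPdist_le => e e0.
have e2 : 0 < e / 2 by rewrite divr_gt0.
have [r0 r00 r0P] := interval_nbhs tT.
have [r1 r10 r1P] := uniform_time_continuity M0 uL uL2 (inT tT) e2.
have M1 : 0 < M + 1 by rewrite ltr_wpDl.
have e3 : 0 < e / 2 / (M + 1) by rewrite divr_gt0.
have /cvgrPdist_le/(_ _ e3)/nbhs_ballP[r2 /= r20 r2P] := X_near tT.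
apply/nbhs_ballP; exists (Num.min r0 (Num.min r1 r2)) => /=.
  by rewrite !lt_min r00 r10.
move=> s; rewrite /ball/= distrC !lt_min => /and3P[s0 s1 s2].
have sT := inT (r0P _ s0).
have h1 := r1P s sT s1 (X s + c).
have h2 : `|X t - X s| <= e / 2 / (M + 1) by apply: r2P; rewrite /ball/= distrC.
have h3 := uL (inT tT) (X t + c) (X s + c).
have -> : u t (X t + c) - u s (X s + c) =
  (u t (X t + c) - u t (X s + c)) - (u s (X s + c) - u t (X s + c)) by ring.
rewrite (le_trans (ler_normB _ _))//.
move: h2; rewrite ler_pdivlMr//.
have E : X t + c - (X s + c) = X t - X s by ring.
rewrite E in h3; have := normr_ge0 (X t - X s); lra.
Qed.

Let a_continuous (h t : R) : 0 < h <= 2^-1 -> 0 < t < T -> {for t, continuous (a h)}.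
Proof.
move=> /andP[h0 h2] tT.
have h01 : 0 <= h <= 1 by apply/andP; split; lra.
apply: cvgD; last first.
  have c0 : {for t, continuous (fun s => u s (X s))}.
    have -> : (fun s => u s (X s)) = (fun s => u s (X s + 0)).
      by apply/funext => s; rewrite addr0.
    exact: u_near.
  by apply: cvgM; [exact: c0|apply: cvgB; [exact: (@u_near t h tT)|exact: c0]].
apply/cvgrPdist_le => e e0.
have e2 : 0 < e / 2 by rewrite divr_gt0.
have [r0 r00 r0P] := interval_nbhs tT.
have [_ /(within_time_small e2)[r1 r10 r1P]] := utL2 (inT tT).
have C1 : 0 < 8 * M ^+ 2 + 1 by rewrite ltr_wpDl// mulr_ge0.
have e3 : 0 < e / 2 / (8 * M ^+ 2 + 1) by rewrite divr_gt0.
have /cvgrPdist_le/(_ _ e3)/nbhs_ballP[r2 /= r20 r2P] := X_near tT.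
apply/nbhs_ballP; exists (Num.min r0 (Num.min r1 r2)) => /=.
  by rewrite !lt_min r00 r10.
move=> s; rewrite /ball/= distrC !lt_min => /and3P[s0 s1 s2].
have sT := inT (r0P _ s0).
have hX : `|X t - X s| <= e / 2 / (8 * M ^+ 2 + 1) by apply: r2P; rewrite /ball/= distrC.
have h1 := window_ut_lipschitz (X t) (X s) (inT tT) (ltW h0).
have mB : measurable_fun setT (ut s \- ut t).
  by apply: measurable_funB; [exact: (mut sT)|exact: (mut (inT tT))].
have h3 := L2_window (X s) h01 mB (r1P s sT s1).
have -> : window (ut t) h (X t) - window (ut s) h (X s) =
  (window (ut t) h (X t) - window (ut t) h (X s)) - window (ut s \- ut t) h (X s).
  by rewrite (window_ut_sub _ h01 sT (inT tT)); ring.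
rewrite (le_trans (ler_normB _ _))//.
move: hX; rewrite ler_pdivlMr//.
by have := normr_ge0 (X t - X s); lra.
Qed.

Let uint (t : R) : in_time T t -> locally_integrable setT (u t).
Proof. by move=> tT; apply: continuous_locally_integrable; exact: cu. Qed.

(* the window may move while u changes: its displacement matters only to second
   order, since the window integral of u_t is Lipschitz in the position *)
Let dA1 (h t : R) : 0 < h <= 2^-1 -> 0 < t < T ->
  is_derive t 1 (fun s => window (u s) h (X s) - window (u t) h (X s))
    (window (ut t) h (X t)).
Proof.
move=> /andP[h0 h2] tT.
have h01 : 0 <= h <= 1 by apply/andP; split; lra.
have tT' := inT tT.
apply/is_derive_epsP => e e0.
have e2 : 0 < e / 2 by rewrite divr_gt0.
have [r0 r00 r0P] := interval_nbhs tT.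
have [r1 r10 r1P] := within_dtime_small e2 (dut tT').
have C1 : 0 < 8 * M ^+ 2 + 1 by rewrite ltr_wpDl// mulr_ge0.
have e3 : 0 < e / 2 / (8 * M ^+ 2 + 1) by rewrite divr_gt0.
have /cvgrPdist_le/(_ _ e3)/nbhs_ballP[r2 /= r20 r2P] := X_near tT.
exists (Num.min r0 (Num.min r1 r2)); first by rewrite !lt_min r00 r10.
move=> s; rewrite !lt_min => /and3P[s0 s1 s2].
have [->|st] := eqVneq s t; first by rewrite !subrr mul0r !subrr normr0 mulr0.
have sT := inT (r0P _ s0).
have hX : `|X s - X t| <= e / 2 / (8 * M ^+ 2 + 1).
  by rewrite distrC; apply: r2P; rewrite /ball/= distrC.
have h1 := window_ut_lipschitz (X s) (X t) tT' (ltW h0).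
pose v x := (u s x - u t x) / (s - t) - ut t x.
have mv : measurable_fun setT v.
  apply: measurable_funB; last exact: mut.
  apply: measurable_funM => //; apply: measurable_funB;
    by apply: continuous_measurable_fun; exact: cu.
have h3 := L2_window (X s) h01 mv (r1P s sT st s1).
have st0 : s - t != 0 by rewrite subr_eq0.
have iu z : in_time T z -> mu.-integrable `[X s, X s + h] (EFin \o u z).
  by move=> zT; apply: locally_integrable_itv; exact: uint.
have iut : mu.-integrable `[X s, X s + h] (EFin \o ut t).
  by apply: Lfun2_window_integrable => //; have [] := utL2 tT'.
have E : (s - t) * window v h (X s) =
    window (u s) h (X s) - window (u t) h (X s) - (s - t) * window (ut t) h (X s).
  rewrite /window -RintegralB//; try exact: iu.
  rewrite -RintegralZl//.
    rewrite -RintegralZl//.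
    rewrite -RintegralB//.
    - by apply: eq_Rintegral => y _; rewrite /v; field.
    - exact: (integrableB _ (iu _ sT) (iu _ tT')).
    - exact: (integrableZl _ (s - t) iut).
  have iB : mu.-integrable `[X s, X s + h] (EFin \o (fun y => (s - t)^-1 * (u s y - u t y))).
    exact: (integrableZl _ _ (integrableB _ (iu _ sT) (iu _ tT'))).
  have -> : v = (fun y => (s - t)^-1 * (u s y - u t y) - ut t y).
    by apply/funext => y; rewrite /v mulrC.
  exact: (integrableB _ iB iut).
have -> : window (u s) h (X s) - window (u t) h (X s) -
    (window (u t) h (X t) - window (u t) h (X t)) - (s - t) * window (ut t) h (X t) =
  (s - t) * (window v h (X s) + (window (ut t) h (X s) - window (ut t) h (X t))).
  by rewrite mulrDr E; ring.
rewrite normrM mulrC ler_wpM2r// (le_trans (ler_normD _ _))//.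
move: hX; rewrite ler_pdivlMr//.
by have := normr_ge0 (X s - X t); lra.
Qed.

Let dA (h t : R) : 0 < h <= 2^-1 -> 0 < t < T -> is_derive t 1 (A h) (a h t).
Proof.
move=> hh tT; have /andP[h0 h2] := hh.
have d1 := dA1 hh tT.
have d2 := @is_derive1_comp _ (window (u t) h) X t _ _
  (is_derive_window (X t) (ltW h0) (uL (inT tT))) (dX tT).
have -> : A h = (fun s => (window (u s) h (X s) - window (u t) h (X s)) +
   (window (u t) h \o X) s) by apply/funext => s; rewrite /A /= subrK.
apply: (is_derive_eq (is_deriveD d1 d2)).
by rewrite /a; congr (_ + _); rewrite mulrC.
Qed.

Let A_average (h t : R) : 0 < h <= 2^-1 -> 0 < t < T ->
  `|A h t - h * u t (X t)| <= M * h ^+ 2.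
Proof.
move=> /andP[h0 h2] tT; have tT' := inT tT.
have Xh : X t <= X t + h by rewrite lerDl ltW.
have ic : mu.-integrable `[X t, X t + h] (EFin \o (fun=> u t (X t))).
  by apply: locally_integrable_itv; apply: continuous_locally_integrable => z; exact: cvg_cst.
have iu : mu.-integrable `[X t, X t + h] (EFin \o u t).
  by apply: locally_integrable_itv; exact: uint.
have -> : h * u t (X t) = \int[mu]_(y in `[X t, X t + h]) u t (X t).
  by rewrite Rintegral_cst//= lebesgue_measure_itvcc//= [X t + h - _]addrAC subrr add0r mulrC.
rewrite /A /window -RintegralB//.
have -> : M * h ^+ 2 = M * h * (X t + h - X t) by ring.
apply: Rintegral_le_bound => //; first exact: (integrableB _ iu ic).
move=> y /andP[Xy yX]; rewrite (le_trans (uL tT' _ _))// ler_wpM2l//.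
by rewrite ger0_norm ?subr_ge0// lerBlDl.
Qed.

(* u(X) (u(X + h) - u(X)) - int u u_x = int (u(X) - u) u_x = O(h^2) *)
Let a_average (h t : R) : 0 < h <= 2^-1 -> 0 < t < T ->
  `|a h t - h * - DP_force t (X t)| <= 9 * M ^+ 2 * h ^+ 2.
Proof.
move=> /andP[h0 h2] tT; have tT' := inT tT.
have Xh : X t < X t + h by rewrite ltrDl.
have [p [mp pM pu up]] := ut_repr tT'.
pose D := `[X t, X t + h]%classic.
have mD : measurable D by rewrite /D.
have mu_ : measurable_fun setT (u t) by apply: continuous_measurable_fun; exact: cu.
have mF : measurable_fun setT (DP_force t).
  by apply: continuous_measurable_fun; exact: continuous_DP_force.
have [FB _ _] := DP_force_bounds tT'.
have iF : mu.-integrable D (EFin \o DP_force t).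
  exact/locally_integrable_itv/(bounded_locally_integrable mF FB).
have iup : mu.-integrable D (EFin \o (fun x => u t x * p x)).
  apply: locally_integrable_itv; apply: (@bounded_locally_integrable _ _ (M * M)).
    exact: measurable_funM.
  by move=> x; rewrite normrM ler_pM// uM.
have ip : mu.-integrable D (EFin \o p).
  exact/locally_integrable_itv/(bounded_locally_integrable mp pM).
have ic (c : R) : mu.-integrable D (EFin \o (fun=> c)).
  by apply: locally_integrable_itv; apply: continuous_locally_integrable => z; exact: cvg_cst.
have icp (c : R) : mu.-integrable D (EFin \o (fun x => c * p x)).
  exact: (integrableZl _ c ip).
have E1 : window (ut t) h (X t) = - (\int[mu]_(x in D) (u t x * p x)) -
    \int[mu]_(x in D) DP_force t x.
  rewrite /window (@Rintegral_ae_eq _ _ _ (fun x => (-1) * (u t x * p x) - DP_force t x))//.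
  - rewrite RintegralB//; last exact: (integrableZl _ (-1) iup).
    by rewrite RintegralZl// mulN1r.
  - by apply: measurable_funTS; exact: mut.
  - apply: measurable_funTS; apply: measurable_funB => //.
    by apply: measurable_funM => //; exact: measurable_funM.
  - move: up; apply: filterS; first exact: (ae_filter_ringOfSetsType mu).
    by move=> x + _; rewrite mulN1r.
have E2 : u t (X t) * (u t (X t + h) - u t (X t)) = \int[mu]_(x in D) (u t (X t) * p x).
  by rewrite RintegralZl// pu.
have E3 : h * DP_force t (X t) = \int[mu]_(x in D) DP_force t (X t).
  by rewrite Rintegral_cst//= lebesgue_measure_itvcc ?(ltW Xh)//= [X t + h - _]addrAC subrr add0r mulrC.
have E4 : \int[mu]_(x in D) ((u t (X t) - u t x) * p x) =
    \int[mu]_(x in D) (u t (X t) * p x) - \int[mu]_(x in D) (u t x * p x).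
  by rewrite -RintegralB//; apply: eq_Rintegral => x _; rewrite mulrBl.
have E5 : \int[mu]_(x in D) (DP_force t x - DP_force t (X t)) =
    \int[mu]_(x in D) DP_force t x - \int[mu]_(x in D) DP_force t (X t).
  by rewrite -RintegralB.
have -> : a h t - h * - DP_force t (X t) =
  \int[mu]_(x in D) ((u t (X t) - u t x) * p x) -
  \int[mu]_(x in D) (DP_force t x - DP_force t (X t)).
  have alg (i1 i2 i3 i4 : R) : - i2 - i3 + i1 + i4 = i1 - i2 - (i3 - i4) by ring.
  by rewrite /a E1 E2 mulrN opprK E3 E4 E5 alg.
have len : X t + h - X t = h by ring.
have inD x : X t <= x <= X t + h -> `|x - X t| <= h.
  by move=> /andP[? ?]; rewrite ger0_norm ?subr_ge0// lerBlDl.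
have B1 : `|\int[mu]_(x in D) ((u t (X t) - u t x) * p x)| <= M * h * M * (X t + h - X t).
  apply: Rintegral_le_bound; first exact: ltW.
    have -> : (fun x => (u t (X t) - u t x) * p x) = (fun x => u t (X t) * p x - u t x * p x).
      by apply/funext => x; rewrite mulrBl.
    exact: (integrableB _ (icp (u t (X t))) iup).
  move=> x xD; rewrite normrM ler_pM// (le_trans (uL tT' _ _))// ler_wpM2l//.
  by rewrite distrC inD.
have B2 : `|\int[mu]_(x in D) (DP_force t x - DP_force t (X t))| <=
    8 * M ^+ 2 * h * (X t + h - X t).
  apply: Rintegral_le_bound; first exact: ltW.
    exact: (integrableB _ iF (ic _)).
  move=> x xD; have xh := inD x xD.
  apply: le_trans (DP_force_locally_lipschitz tT' (le_trans xh h2)) _.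
  by rewrite ler_wpM2l// mulr_ge0.
apply: le_trans (ler_normB _ _) _; apply: le_trans (lerD B1 B2) _; rewrite len.
have -> : M * h * M * h + 8 * M ^+ 2 * h * h = 9 * M ^+ 2 * h ^+ 2 by ring.
exact: lexx.
Qed.

(** The window averages A h / h converge to u at the particle and their
derivatives to - F, both at rate h. *)
Lemma characteristic_equation (t : R) : 0 < t < T ->
  is_derive t 1 (fun s => u s (X s)) (- DP_force t (X t)).
Proof.
have h0 : (0 : R) < 2^-1 by [].
have C0 : 0 <= M + 9 * M ^+ 2 by rewrite addr_ge0// mulr_ge0.
apply: (@derive_of_averages R (fun s => u s (X s)) (fun s => - DP_force s (X s))
  A a 0 T (M + 9 * M ^+ 2) 2^-1 h0 C0) => h s hh sT; split.
- exact: dA.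
- exact: a_continuous.
- apply: le_trans (A_average hh sT) _.
  by rewrite ler_wpM2r ?sqr_ge0// lerDl mulr_ge0.
- apply: le_trans (a_average hh sT) _.
  by rewrite ler_wpM2r ?sqr_ge0// lerDr.
Qed.

End CharacteristicEquation.

(** * Strong solutions and their flow *)

Section StrongSolutions.
Context {R : realType}.
Local Notation mu := (@lebesgue_measure R).

Lemma C_H1_C_L2 (T : R) (u : R -> R -> R) : C_H1 T u -> C_L2 T u.
Proof.
move=> uH t tT; have [[_ ut _] uN] := uH t tT; split => //.
apply: squeeze_cvge (cvg_cst _) uN.
apply: nearW => s; rewrite Lp_norm_ge0/=.
by rewrite /W1_norm leeDl// Lp_norm_ge0.
Qed.

(** The flow equation at a time t of [0, T], one-sided at the endpoints, as an
estimate without division. *)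
Lemma is_flow_quotient (T : R) u Phi (y t e : R) : is_flow T u Phi -> in_time T t ->
  0 < e -> exists2 r : R, 0 < r & forall s, in_time T s -> `|s - t| < r ->
    `|Phi s y - Phi t y - (s - t) * u t (Phi t y)| <= e * `|s - t|.
Proof.
move=> /(_ y)[_ +] tT e0 => /(_ t tT)/cvgrPdist_le/(_ _ e0).
rewrite near_withinE near_withinE => /nbhs_ballP[r /= r0 rP].
exists r => // s sT sr.
have [->|st] := eqVneq s t; first by rewrite !subrr mul0r subrr normr0 mulr0.
have st0 : s - t != 0 by rewrite subr_eq0.
have := rP s; rewrite /ball/= distrC => /(_ sr st sT) h.
have -> : Phi s y - Phi t y - (s - t) * u t (Phi t y) =
  - ((u t (Phi t y) - (Phi s y - Phi t y) / (s - t)) * (s - t)) by field.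
by rewrite normrN normrM ler_wpM2r.
Qed.

Lemma is_flow_is_derive (T : R) u Phi (y t : R) : is_flow T u Phi -> 0 < t < T ->
  is_derive t 1 (Phi ^~ y) (u t (Phi t y)).
Proof.
move=> flow /andP[t0 tT]; apply/is_derive_epsP => e e0.
have tT' : in_time T t by rewrite /in_time/= !ltW.
have [r r0 rP] := is_flow_quotient y flow tT' e0.
exists (Num.min r (Num.min t (T - t))).
  by rewrite !lt_min r0 t0 subr_gt0.
move=> s; rewrite !lt_min => /and3P[sr].
rewrite !ltr_norml => /andP[? ?] /andP[? ?].
by apply: rP => //; rewrite /in_time/=; apply/andP; split; lra.
Qed.

Lemma is_flow_continuous (T : R) u Phi (y : R) : is_flow T u Phi ->
  {within `[0, T], continuous (Phi ^~ y)}.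
Proof.
move=> flow; apply/subspace_continuousP => t; rewrite /= in_itv/= => tT.
have [r r0 rP] := is_flow_quotient y flow tT ltr01.
apply/cvgrPdist_le => e e0; rewrite near_withinE.
set V := `|u t (Phi t y)| + 1.
have V0 : 0 < V by rewrite ltr_wpDl.
apply/nbhs_ballP; exists (Num.min r (e / V)) => /=.
  by rewrite lt_min r0 divr_gt0.
move=> s; rewrite /ball/= distrC lt_min in_itv/= => /andP[sr].
rewrite ltr_pdivlMr// => se sT.
have := rP s sT sr; rewrite mul1r => h; rewrite distrC.
have -> : Phi s y - Phi t y = (Phi s y - Phi t y - (s - t) * u t (Phi t y))
  + (s - t) * u t (Phi t y) by ring.
rewrite (le_trans (ler_normD _ _))// normrM.
by move: se; rewrite /V; lra.
Qed.

Lemma continuous_along_flow (T M : R) u Phi (y : R) : 0 <= M -> C_L2 T u ->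
  (forall t, in_time T t -> forall x y, `|u t x - u t y| <= M * `|x - y|) ->
  is_flow T u Phi -> {within `[0, T], continuous (fun t => u t (Phi t y))}.
Proof.
move=> M0 uL2 uL flow; apply/subspace_continuousP => t; rewrite /= in_itv/= => tT.
have /subspace_continuousP/(_ t) := @is_flow_continuous T u Phi y flow.
rewrite /= in_itv/= => /(_ tT) cX.
apply/cvgrPdist_le => e e0.
have e2 : 0 < e / 2 by rewrite divr_gt0.
have M1 : 0 < M + 1 by rewrite ltr_wpDl.
have e3 : 0 < e / 2 / (M + 1) by rewrite divr_gt0.
have [r r0 rP] := uniform_time_continuity M0 uL uL2 tT e2.
move: cX => /cvgrPdist_le/(_ _ e3); rewrite !near_withinE => cX.
have nr : \forall s \near t, `|s - t| < r.
  by apply/nbhs_ballP; exists r => //= s; rewrite /ball/= distrC.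
move: cX nr; apply: filterS2 => s cX sr sT.
have := cX sT; rewrite ler_pdivlMr// => h.
have sT' : in_time T s by move: sT; rewrite /= in_itv.
have h1 := rP s sT' sr (Phi s y).
have h2 := uL t tT (Phi t y) (Phi s y).
have -> : u t (Phi t y) - u s (Phi s y) =
  (u t (Phi t y) - u t (Phi s y)) - (u s (Phi s y) - u t (Phi s y)) by ring.
rewrite (le_trans (ler_normB _ _))//.
by have := normr_ge0 (Phi t y - Phi s y); lra.
Qed.

End StrongSolutions.

Theorem corollary1p10 (R : realType) (delta : R) (u0 : R -> R)
  (Omega : set R) (N : nat) (xtilde : 'I_N -> R)
  (T : R) (u : R -> R -> R) (Phi : R -> R -> R)
  (delta_gt0 : 0 < delta)
  (u0_continuous : continuous u0)
  (u0_Hs : Hs (1 + delta) u0)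
  (u0_W1infty : W1 +oo%E u0)
  (Omega_open : open Omega)
  (u0_C1 : C1_on (Omega `\` range xtilde) u0)
  (T_gt0 : 0 < T)
  (u_sol : DP_strong_solution delta T u0 u)
  (Phi_flow : is_flow T u Phi) :
  forall t : R, 0 <= t <= T ->
    C1_on ((Phi t @` Omega) `\` range (fun j : 'I_N => Phi t (xtilde j))) (u t).
Proof.
move=> t tT.
have [u0E cu uH1 _ uLip [ut [utL2 dut ut_eq]] _] := u_sol.
have uL2 := C_H1_C_L2 uH1.
have [M M0 uM] := uniform_lipschitz T_gt0 cu uL2 uLip.
have uB s : in_time T s -> forall x, `|u s x| <= M by move=> /uM[].
have uL s : in_time T s -> forall x y, `|u s x - u s y| <= M * `|x - y| by move=> /uM[].
have uW s : in_time T s -> exists g, is_weak_deriv (u s) g by move=> /uH1[[]].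
have T0 := ltW T_gt0.
have C0 : 0 <= 9 * M ^+ 2 by rewrite mulr_ge0// sqr_ge0.
have Phi0 y : Phi 0 y = y by have [] := Phi_flow y.
have cX y := @is_flow_continuous _ T u Phi y Phi_flow.
have cU y := @continuous_along_flow _ T M u Phi y M0 uL2 uL Phi_flow.
have dX s y : 0 < s < T -> is_derive s 1 (Phi ^~ y) (u s (Phi s y)).
  exact: is_flow_is_derive Phi_flow.
have dU s y : 0 < s < T ->
    is_derive s 1 (fun r => u r (Phi r y)) (- DP_force u s (Phi s y)).
  exact: (characteristic_equation M0 uB uL uL2 utL2 dut uW ut_eq
    (X := Phi ^~ y) (fun r => @dX r y)).
have LU s y z : 0 <= s <= T ->
    `|u s (Phi s y) - u s (Phi s z)| <= M * `|Phi s y - Phi s z|.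
  by move=> sT; exact: uL.
have FG s x x' : 0 < s < T -> `|x' - x| <= 2^-1 ->
    `|DP_force u s x' - DP_force u s x - (x' - x) * DP_force_slope u s x| <=
    9 * M ^+ 2 * (x' - x) ^+ 2.
  move=> /andP[s0 sT]; have sT' : in_time T s by rewrite /in_time/= !ltW.
  by have [_ _] := DP_force_bounds uB uL sT'; apply.
set W := Omega `\` range xtilde.
have oW : open W.
  rewrite /W setDE.
  apply: openI => //; apply: closed_openC.
  have /accessible_finite_set_closed := hausdorff_accessible (@Rhausdorff R).
  by apply; exact: finite_image.
(* the good initial points are carried by the flow *)
have transport z : W z -> slopes_cauchy (u t) (Phi t z).
  move=> Wz; apply: (flow_slopes_cauchy T0 M0 C0 Phi0 cX cU dX dU LU FG (v := u)) => //.
  rewrite u0E; apply: C1_slopes_cauchy; last by have [] := u0_C1 z Wz.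
  by apply: filterS (open_nbhs_nbhs (conj oW Wz)) => w /u0_C1[].
move=> _ [[y Oy <-] ny].
have Wy : W y.
  by split=> // -[j _ jy]; apply: ny; exists j => //=; rewrite jy.
apply: slopes_cauchy_C1.
have /nbhs_ballP[r /= r0 rP] : nbhs y W by exact: open_nbhs_nbhs.
set K := flow_growth T M.
have K0 : 0 < K by exact: expR_gt0.
apply/nbhs_ballP; exists (Num.min 1 (r / K)) => /=.
  by rewrite lt_min ltr01 divr_gt0.
move=> x; rewrite /ball/= distrC lt_min => /andP[x1].
rewrite ltr_pdivlMr// => xr.
have [z zx zy] := flow_nbhs_surjective T0 M0 Phi0 cX dX LU tT x1.
rewrite -zx; apply: transport; apply: rP; rewrite /ball/= distrC.
by apply: le_lt_trans zy _; move: xr; rewrite mulrC.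
Qed.
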